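(* Let $\gamma\colon [a,b]\to \mathbb{R}^{4}$ be a horizontal curve in the Engel group. Suppose $$S:=\{t\in [a,b]:\gamma'(t)\notin \mathrm{Span}(X_{2}) \}$$ satisfies $m(S)>0$. Then for any $\varepsilon>0$ there exists a $C^{1}$ horizontal curve $\Gamma\colon [a,b]\to \mathbb{R}^{4}$ in the Engel group such that $$m\{t\in [a,b]:\Gamma(t)=\gamma(t)\}>m(S)-\varepsilon.$$
   Context: $m$ denotes Lebesgue measure on $\mathbb{R}$. The Engel group $\mathbb{E}$ is the connected, simply connected Lie group whose Lie algebra is $V_1\oplus V_2\oplus V_3$ with $V_1=\mathrm{span}\{X_1,X_2\}$, $V_2=\mathrm{span}\{X_3\}$, $V_3=\mathrm{span}\{X_4\}$ (of dimension 4) and only non-zero brackets of basis vectors $[X_1,X_2]=X_3$, $[X_1,X_3]=X_4$ (up to antisymmetry). It is identified with $\mathbb{R}^4$ by exponential coordinates of the second kind, $(x_1,x_2,x_3,x_4)\leftrightarrow\exp(x_4X_4)\exp(x_3X_3)\exp(x_2X_2)\exp(x_1X_1)$, in which the horizontal left invariant vector fields are $X_1(x)=\partial_1$ and $X_2(x)=\partial_2+x_1\partial_3+\tfrac12x_1^2\partial_4$. A curve $\gamma:[a,b]\to\mathbb{R}^4$ is horizontal if it is absolutely continuous and for almost every $t\in[a,b]$ its Euclidean derivative has the form $\dot\gamma(t)=u_1(t)X_1(\gamma(t))+u_2(t)X_2(\gamma(t))$ with $u_1(t),u_2(t)\in\mathbb{R}$. At such $t$ one writes $\gamma'(t):=u_1(t)X_1+u_2(t)X_2\in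 V_1$, viewed as an element of the Lie algebra; so $\gamma'$ is defined for almost every $t$ and $S$ is defined up to a null set. A $C^1$ horizontal curve is a horizontal curve that is continuously differentiable as a map into $\mathbb{R}^4$. *)

(* Defs.v *)
From mathcomp Require Export all_boot all_order all_algebra.
From mathcomp Require Export all_classical all_reals all_analysis.
Export Order.TTheory GRing.Theory Num.Theory.
Export numFieldNormedType.Exports.

Set Implicit Arguments.
Unset Strict Implicit.
Unset Printing Implicit Defensive.

Local Open Scope classical_set_scope.
Local Open Scope ring_scope.

(* Curves on [a, b] are total functions on R of which only the values on [a, b]
   matter: no notion below looks at f outside [a, b]. *)
Section Curves.
Context {R : realType} {V : normedModType R}.
Implicit Types (a b t : R) (f : R -> V) (l : V).

(* Possibly degenerate intervals (u = v) are allowed in the family; they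
   contribute 0 to both sums. *)
Definition absolutely_continuous a b f : Prop :=
  forall e : R, 0 < e -> exists2 d : R, 0 < d &
    forall (n : nat) (u v : 'I_n -> R),
      (forall i, a <= u i /\ u i <= v i /\ v i <= b) ->
      trivIset [set: 'I_n] (fun i => `]u i, v i[%classic) ->
      \sum_(i < n) (v i - u i) < d ->
      \sum_(i < n) `|f (v i) - f (u i)| < e.

(* f, as a map on [a, b], has derivative l at t; this is the one-sided
   derivative when t is an end point. *)
Definition has_derivative_on a b f t l : Prop :=
  (s - t)^-1 *: (f s - f t) @[s --> within `[a, b]%classic t^'] --> l.

Definition C1_on a b f : Prop :=
  exists2 df : R -> V, {within `[a, b]%classic, continuous df} &
    forall t, t \in `[a, b] -> has_derivative_on a b f t (df t).

Lemma has_derivative_on_is_derive a b f t l :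
  t \in `]a, b[ -> has_derivative_on a b f t l <-> is_derive t 1 f l.
Proof.
move=> tab.
have E : is_derive t 1 f l <->
    h^-1 *: (f (h *: 1 + t) - f t) @[h --> 0^'] --> l.
  split=> [[df <-]|H]; first exact: df.
  apply: DeriveDef; first by apply/cvg_ex; exists l.
  exact: cvg_lim H.
rewrite E; split=> /cvgrPdist_lt H; apply/cvgrPdist_lt => e e0.
- have /nbhs_ballP[d /= d0 Hd] := H e e0.
  have /nbhs_ballP[r /= r0 Hr] := near_in_itvoo tab.
  exists (Num.min d r) => /=; first by rewrite lt_min d0.
  move=> h /=; rewrite sub0r normrN lt_min => /andP[hd hr] h0.
  rewrite [h *: 1]mulr1 -[in X in X^-1](addrK t h); apply: (Hd (h + t)).
  + by rewrite /ball/= opprD addrCA subrr addr0 normrN.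
  + by rewrite -subr_eq0 addrK.
  + apply/subset_itv_oo_cc/Hr.
    by rewrite /ball/= opprD addrCA subrr addr0 normrN.
- have /nbhs_ballP[d /= d0 Hd] := H e e0.
  exists d => //= s /= hs st _.
  have := Hd (s - t); rewrite /ball /= sub0r normrN distrC subr_eq0.
  by rewrite [_ *: 1]mulr1 subrK; apply.
Qed.

End Curves.

(* The Engel group is R^4 in exponential coordinates of the second kind,
   x <-> exp(x_4 X_4) exp(x_3 X_3) exp(x_2 X_2) exp(x_1 X_1), with [X_1, X_2] = X_3
   and [X_1, X_3] = X_4; the vector fields below are X_1 and X_2 in these
   coordinates. Row vectors serve both as points x = (x_1, x_2, x_3, x_4) (and
   tangent vectors in the coordinates d_1, ..., d_4) and as elements of the Lie
   algebra in the basis X_1, ..., X_4. Indices are shifted: x_1 is [x 0 0]. *)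
Section Engel.
Context {R : realType}.
Implicit Types (a b t : R) (x v : 'rV[R]_4) (gamma : R -> 'rV[R]_4).

Definition engel_X1 : 'rV[R]_4 := delta_mx 0 0.
Definition engel_X2 : 'rV[R]_4 := delta_mx 0 1.

Definition engel_field1 x : 'rV[R]_4 := delta_mx 0 0.
Definition engel_field2 x : 'rV[R]_4 :=
  delta_mx 0 1 + x 0 0 *: delta_mx 0 2 + (x 0 0 ^+ 2 / 2) *: delta_mx 0 3.

(* The relation "gamma'(t) is defined and equals v", v being an element of the
   Lie algebra rather than a tangent vector at gamma t. *)
Definition horizontal_velocity a b gamma t v : Prop :=
  exists u1 u2 : R,
    has_derivative_on a b gamma t
      (u1 *: engel_field1 (gamma t) + u2 *: engel_field2 (gamma t)) /\
    v = u1 *: engel_X1 + u2 *: engel_X2.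

Definition horizontal_curve a b gamma : Prop :=
  absolutely_continuous a b gamma /\
  {ae lebesgue_measure, forall t : R,
     t \in `[a, b] -> exists v, horizontal_velocity a b gamma t v}.

Definition C1_horizontal_curve a b gamma : Prop :=
  horizontal_curve a b gamma /\ C1_on a b gamma.

(* The points where gamma' is undefined (a null set if gamma is horizontal) are
   left out. *)
Definition velocity_notin_span_X2 a b gamma : set R :=
  [set t | t \in `[a, b] /\
     exists2 v, horizontal_velocity a b gamma t v & v \notin <[engel_X2]>%VS].

End Engel.

(* Main.v *)
From HB Require Import structures.
Require Import Defs.
From mathcomp Require Import ring lra measurable_realfun.
From mathcomp Require Import lebesgue_stieltjes_measure.

(** On a horizontal curve with coordinates x1, ..., x4 and controls u1, u2, a
    point where the velocity leaves the span of X2 is a point where u1 != 0.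
    The C1 curve is produced by a Whitney extension theorem: a closed set K
    carrying most of {u1 != 0} is selected, the curve is kept on K, and every
    gap of K is filled by an explicit horizontal arc.

    Selection of K.  Translating the curve to the left so that it starts at the
    identity replaces the increments of x3 and x4 over [t, s] by
      int (x1 - x1(t)) u2   and   int (x1 - x1(t))^2 / 2 u2.
    At almost every t they are u1 u2 / 2 (s-t)^2 and u1^2 u2 / 6 (s-t)^3 up to
    errors of smaller order (second_order_expansion, third_order_expansion): x1
    and x2 are differentiable at t, and the variation of x2 over [t, s] is
    O(|s - t|) at almost every t by a covering argument (steep_negligible).
    The integrals never appear; in their place, an absolutely continuous
    function whose derivative is dominated almost everywhere by the growth of a
    monotone function has increments dominated by that function
    (absolutely_continuous_growth).  An argument in the style of Egorov
    (uniform_limit_off_small_set) makes all the quotients converge uniformly on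
    a large closed set, on which u1 and u2 are then continuous
    (large_whitney_set); shrinking it further makes u1 bounded away from 0
    (large_transversal_set).

    Filling a gap.  Where u1 != 0, x1 can serve as the parameter: with
    p = dx2/dx1, the displacements of x2, x3, x4 are the moments of order 0, 1, 2
    of p, up to factorials.  With x1 a cubic in time having the right end values
    and slopes, a polynomial p of degree 4 therefore realizes the required
    displacements and the two required end values of p (gap_arc).  The formula makes
    sense as soon as x1 differs at the two ends, hence on all short gaps; the
    other gaps are crossed through an intermediate point (connecting_arc).  On
    short gaps the expansions say that the moments are almost those of the
    constant p = u2/u1, so the controls on the gap are close to those at its
    ends (cvg_gap_u1, cvg_gap_u2).

    Gluing.  Closeness on short gaps, together with continuity of each arc, gives
    continuity of the glued controls (glue_continuous); the mean value theorem
    then differentiates the glued curve at the points of K (glue_derive). *)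

Set Implicit Arguments.
Unset Strict Implicit.
Unset Printing Implicit Defensive.

Local Open Scope classical_set_scope.
Local Open Scope ring_scope.

(** * Increments of absolutely continuous functions *)

Section Increments.
Context {R : realType}.

(** Cousin's lemma for an additive property of intervals: the supremum of the
    points that are reached from a is reached, and can be passed unless it
    is b. *)
Lemma cousin (a b : R) (P : R -> R -> Prop) : a <= b ->
  (forall u w v, u <= w -> w <= v -> P u w -> P w v -> P u v) ->
  (forall t, a <= t <= b -> exists2 d : R, 0 < d &
     forall u v, a <= u -> u <= t -> t <= v -> v <= b ->
       t - d < u -> v < t + d -> P u v) ->
  P a b.
Proof.
move=> ab Pcat Ploc.
pose A := [set t | a <= t <= b /\ P a t].
have Aa : A a.
  have [|d d0 H] := Ploc a; first by rewrite lexx ab.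
  by split; [rewrite lexx ab|apply: H => //; rewrite ?gtrBl ?ltrDl].
have Ab : ubound A b by move=> t [/andP[]].
have sA : has_sup A by split; [exists a|exists b].
set s := sup A.
have as_ : a <= s by apply: ub_le_sup => //; exists b.
have sb : s <= b by apply: ge_sup => //; exists a.
have [|d d0 H] := Ploc s; first by rewrite as_ sb.
have [t [/andP[at_ tb] Pt] ts] : exists2 t, A t & s - d < t.
  by apply: sup_adherent.
have tles : t <= s by apply: ub_le_sup; [exists b|split => //; rewrite at_ tb].
have Pext v : s <= v -> v <= b -> v < s + d -> P a v.
  by move=> sv vb vd; apply: (Pcat a t v) => //; [exact: le_trans sv|exact: H].
have [bsd|bsd] := ltP b (s + d); first exact: Pext.
have : A (s + d / 2).
  split; first by apply/andP; split; lra.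
  by apply: Pext; lra.
have /ubP ubA := @ub_le_sup R A (ex_intro _ b Ab).
by move=> /ubA; rewrite -/s; lra.
Qed.

(** Lists of consecutive intervals, which concatenate more easily than
    families indexed by ordinals. *)
Definition ordered_in (a b : R) (l : seq (R * R)) :=
  all (fun x => [&& a <= x.1, x.1 <= x.2 & x.2 <= b]) l &&
  pairwise (fun x y : R * R => x.2 <= y.1) l.

Lemma ordered_in_cat (a c b : R) l1 l2 : a <= c -> c <= b ->
  ordered_in a c l1 -> ordered_in c b l2 -> ordered_in a b (l1 ++ l2).
Proof.
move=> ac cb /andP[/allP A1 P1] /andP[/allP A2 P2].
rewrite /ordered_in all_cat pairwise_cat P1 P2 !andbT /=.
apply/andP; split; first (apply/andP; split).
- by apply/allP => x /A1 /and3P[? ? /le_trans xc]; apply/and3P; split => //; exact: xc.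
- by apply/allP => x /A2 /and3P[/(le_trans ac) ? ? ?]; apply/and3P; split.
- apply/allrelP => x y /A1 /and3P[_ _ h] /A2 /and3P[h' _ _].
  exact: le_trans h'.
Qed.

Lemma ordered_in_trivIset (a b : R) l : ordered_in a b l ->
  trivIset [set: 'I_(size l)]
    (fun i => `](nth (0, 0) l i).1, (nth (0, 0) l i).2[%classic).
Proof.
move=> /andP[_ /(pairwiseP (0,0)) P]; apply/trivIsetP => i j _ _ ij.
wlog ltij : i j ij / (i < j)%N.
  move=> W; have [?|?|/ord_inj e] := ltngtP i j; first exact: W.
  - by rewrite setIC; apply: W => //; rewrite eq_sym.
  - by rewrite e eqxx in ij.
have h := P i j (ltn_ord i) (ltn_ord j) ltij.
apply/seteqP; split => // x [/=]; rewrite !in_itv /= => /andP[_ x1] /andP[x2 _].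
by have := lt_trans x1 (le_lt_trans h x2); rewrite ltxx.
Qed.

Lemma absolutely_continuous_seq (V : normedModType R) a b (f : R -> V) :
  absolutely_continuous a b f -> forall e, 0 < e -> exists2 d, 0 < d &
  forall l, ordered_in a b l -> \sum_(x <- l) (x.2 - x.1) < d ->
    \sum_(x <- l) `|f x.2 - f x.1| < e.
Proof.
move=> H e /H[d d0 {}H]; exists d => // l lo.
rewrite !(big_nth (0, 0)) !big_mkord => ld.
apply: (H _ (fun i => (nth (0, 0) l i).1) (fun i => (nth (0, 0) l i).2)) => //.
- move=> i; move: lo => /andP[/allP A _].
  by have /A/and3P[] := mem_nth (0,0) (ltn_ord i).
- exact: ordered_in_trivIset lo.
Qed.

Lemma ordered_in_measure (a b : R) l (U : set R) : ordered_in a b l ->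
  measurable U ->
  (forall x, x \in l -> `]x.1, x.2[%classic `<=` U) ->
  ((\sum_(x <- l) (x.2 - x.1))%:E <= lebesgue_measure U)%E.
Proof.
move=> lo mU lU; pose B (i : nat) := (`](nth (0, 0) l i).1, (nth (0, 0) l i).2[%classic : set R).
have tB : trivIset `I_(size l) B.
  apply/trivIsetP => i j /= il jl ij.
  have /trivIsetP/(_ (Ordinal il) (Ordinal jl) Logic.I Logic.I) := ordered_in_trivIset lo.
  by apply; apply: contra_neq ij => -[].
have mB i : measurable (B i) by exact: measurable_itv.
apply: (@le_trans _ _ (lebesgue_measure (\big[setU/set0]_(i < size l) B i))); last first.
  apply: le_measure; rewrite ?inE //; first by apply: bigsetU_measurable => i _; exact: mB.
  move=> x; rewrite -bigcup_mkord => -[i /= il]; apply: lU; exact: mem_nth.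
rewrite (@measure_semi_additive_ord_I _ _ _ lebesgue_measure) //.
  rewrite (big_nth (0,0)) big_mkord -sumEFin; apply: lee_sum => i _.
  rewrite /B [leRHS]lebesgue_measure_itv /=; case: ifPn => //; rewrite lte_fin -leNgt => ?.
  by rewrite lee_fin subr_le0.
- by move=> k _; exact: mB.
- by apply: bigsetU_measurable => i _; exact: mB.
Qed.

Lemma absolutely_continuous_lip (V1 V2 W : normedModType R) a b
    (f : R -> V1) (g : R -> V2) (F : R -> W) L :
  (forall u v, a <= u -> u <= v -> v <= b ->
     `|F v - F u| <= L * (`|f v - f u| + `|g v - g u|)) ->
  absolutely_continuous a b f -> absolutely_continuous a b g ->
  absolutely_continuous a b F.
Proof.
move=> HL fac gac e e0.
pose L' := Num.max L 1; have L'0 : 0 < L' by rewrite lt_max ltr01 orbT.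
have e'0 : 0 < e / L' / 2 by rewrite !divr_gt0.
have [d1 d10 H1] := fac _ e'0; have [d2 d20 H2] := gac _ e'0.
exists (Num.min d1 d2); first by rewrite lt_min d10.
move=> n u v uv tuv; rewrite lt_min => /andP[sd1 sd2].
have {}H1 := H1 n u v uv tuv sd1; have {}H2 := H2 n u v uv tuv sd2.
apply: (@le_lt_trans _ _ (L' * (\sum_(i < n) `|f (v i) - f (u i)| +
    \sum_(i < n) `|g (v i) - g (u i)|))).
  rewrite -big_split /= mulr_sumr; apply: ler_sum => i _.
  have [h1 [h2 h3]] := uv i; apply: (le_trans (HL _ _ h1 h2 h3)).
  by apply: ler_wpM2r; [rewrite addr_ge0|rewrite le_max lexx].
by rewrite mulrC -ltr_pdivlMr // [ltRHS]splitr ltrD.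
Qed.

(** Each point off the null set N has small neighbourhoods where F grows at most
    like W, and an open set of small measure covers N.  Cousin's lemma chains the
    two kinds of intervals: those of the first kind add up to the increment of
    W, and absolute continuity makes the sum over the second kind small. *)
Lemma absolutely_continuous_growth (V : normedModType R) (a b : R) (F : R -> V) (W : R -> R) N :
  a <= b -> absolutely_continuous a b F ->
  {in `[a, b] &, {homo W : x y / x <= y}} ->
  lebesgue_measure.-negligible N ->
  (forall t, a <= t <= b -> ~ N t -> forall e, 0 < e -> exists2 d, 0 < d &
     forall s, a <= s <= b -> `|s - t| < d ->
       `|F s - F t| <= `|W s - W t| + e * `|s - t|) ->
  `|F b - F a| <= W b - W a.
Proof.
move=> ab Fac Wnd /negligible_outer_measure N0 Hloc.
apply/ler_addgt0Pr => e e0.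
have e20 : 0 < e / 2 by rewrite divr_gt0.
have [d d0 Hd] := absolutely_continuous_seq Fac e20.
have [//|U [oU NU mU]] := @outer_measure_open_le R N (d / 2); first by rewrite divr_gt0.
rewrite N0 add0e in mU.
(* b - a + 1 instead of b - a keeps the quotient meaningful when a = b *)
pose eta := e / 2 / (b - a + 1).
have ba1 : 0 < b - a + 1 by rewrite ltr_wpDl ?subr_ge0.
have eta0 : 0 < eta by rewrite divr_gt0.
pose P u v := exists l, [/\ ordered_in u v l,
  forall x, x \in l -> `]x.1, x.2[%classic `<=` U &
  `|F v - F u| <= W v - W u + eta * (v - u) + \sum_(x <- l) `|F x.2 - F x.1| ].
have : P a b.
  apply: cousin => //.
  - move=> u w v uw wv [l1 [s1 U1 H1]] [l2 [s2 U2 H2]]; exists (l1 ++ l2); split.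
    + exact: ordered_in_cat s1 s2.
    + by move=> x; rewrite mem_cat => /orP[/U1|/U2].
    + rewrite big_cat /=.
      have := ler_normD (F v - F w) (F w - F u); rewrite subrKA => /le_trans; apply.
      by apply: le_trans (lerD H2 H1) _; lra.
  move=> t tab; have [Nt|nNt] := pselect (N t).
  - have /nbhs_ballP[r /= r0 rU] := open_nbhs_nbhs (conj oU (NU _ Nt)).
    exists r => // u v au ut tv vb tu vt; exists [:: (u, v)]; split.
    + by rewrite /ordered_in /= !lexx (le_trans ut tv).
    + move=> x; rewrite inE => /eqP -> /= y /=; rewrite in_itv /= => /andP[uy yv].
      by apply: rU; rewrite /ball /= ltr_distlC; apply/andP; split; lra.
    + have uv := le_trans ut tv.
      have eu : 0 <= eta * (v - u) by apply: mulr_ge0; rewrite ?subr_ge0 // ltW.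
      rewrite big_seq1 /= lerDr addr_ge0 // subr_ge0.
      by apply: Wnd => //; rewrite in_itv /= ?au ?vb ?(le_trans uv vb) ?(le_trans au uv).
  - have [r r0 H] := Hloc t tab nNt _ eta0.
    exists r => // u v au ut tv vb tu vt; exists [::]; split => //.
    rewrite big_nil addr0.
    have ub : a <= u <= b by rewrite au (le_trans ut) // (le_trans tv).
    have vab : a <= v <= b by rewrite vb (le_trans au) // (le_trans ut).
    have H1 := H u ub; have H2 := H v vab.
    have Wu : W u <= W t by apply: Wnd; rewrite ?in_itv.
    have Wv : W t <= W v by apply: Wnd; rewrite ?in_itv.
    move: H1; rewrite ler0_norm ?subr_le0 // ltrNl => /(_ _) H1.
    have {}H1 : `|F u - F t| <= W t - W u + eta * (t - u).
      apply: (le_trans (H1 _)); first lra.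
      by rewrite ler0_norm ?subr_le0 // !opprB.
    have {}H2 : `|F v - F t| <= W v - W t + eta * (v - t).
      rewrite !ger0_norm ?subr_ge0 // in H2; apply: H2; lra.
    have := ler_normD (F v - F t) (F t - F u); rewrite subrKA => /le_trans; apply.
    rewrite (distrC (F t)); apply: (le_trans (lerD H2 H1)); lra.
move=> [l [lo lU]] /le_trans; apply.
have := ordered_in_measure lo (open_measurable oU) lU => /le_trans /(_ mU).
rewrite lee_fin => ld.
have {}ld : \sum_(x <- l) (x.2 - x.1) < d by apply: (le_lt_trans ld); lra.
have := Hd l lo ld => h.
have : eta * (b - a) <= e / 2.
  by rewrite /eta mulrAC ler_pdivrMr // ler_wpM2l //; lra.
lra.
Qed.

End Increments.

(** * Total variation and its difference quotients *)

Section Variation.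
Context {R : realType}.

Definition clamp (a b t : R) := Num.max a (Num.min t b).

Lemma clamp_itv (a b t : R) : a <= b -> a <= clamp a b t <= b.
Proof. by move=> ab; rewrite /clamp le_max lexx /= ge_max ab ge_min lexx orbT. Qed.

Lemma clamp_id (a b t : R) : a <= t <= b -> clamp a b t = t.
Proof. by move=> /andP[at_ tb]; rewrite /clamp min_l // max_r. Qed.

Lemma clamp_mono (a b s t : R) : s <= t -> clamp a b s <= clamp a b t.
Proof. by move=> st; rewrite /clamp ge_max !le_max lexx /= le_min !ge_min st lexx !orbT. Qed.

Lemma continuous_clamp (a b : R) : continuous (clamp a b).
Proof.
move=> t; apply: (@continuous_max _ _ (cst a) (fun t => Num.min t b)).
  exact: cvg_cst.
by apply: (@continuous_min _ _ id (cst b)); [exact: cvg_id|exact: cvg_cst].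
Qed.

Lemma continuous_comp_clamp (V : normedModType R) (a b : R) (f : R -> V) : a <= b ->
  {within `[a, b], continuous f} -> continuous (f \o clamp a b).
Proof.
move=> ab /subspace_continuousP fc t; apply: (@cvg_comp _ _ _ (clamp a b) f) (fc _ _); last first.
  by rewrite /= in_itv /= clamp_itv.
move=> A /= nA; have := @continuous_clamp a b t _ nA; rewrite nbhs_simpl /=.
rewrite !near_simpl; apply: filterS => x; apply.
by rewrite /= in_itv /= clamp_itv.
Qed.

Lemma absolutely_continuous_continuous (V : normedModType R) a b (f : R -> V) :
  absolutely_continuous a b f -> {within `[a, b], continuous f}.
Proof.
move=> fac; apply/subspace_continuousP => x /=; rewrite in_itv /= => /andP[ax xb].
apply/cvgrPdist_lt => e e0; have [d d0 H] := absolutely_continuous_seq fac e0.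
rewrite near_withinE; near=> y; rewrite /= in_itv /= => /andP[ay yb].
have xy : `|x - y| < d by near: y; exact: cvgr_dist_lt.
have [le_xy|/ltW le_yx] := leP x y.
- have := H [:: (x, y)]; rewrite !big_seq1 /= distrC; apply.
    by rewrite /ordered_in /= ax le_xy yb.
  by rewrite distrC ger0_norm ?subr_ge0 // in xy.
- have := H [:: (y, x)]; rewrite !big_seq1 /=; apply.
    by rewrite /ordered_in /= ay le_yx xb.
  by rewrite ger0_norm ?subr_ge0 // in xy.
Unshelve. all: by end_near. Qed.

Lemma itv_partition_ordered (a b u v : R) s : a <= u -> v <= b ->
  itv_partition u v s -> ordered_in a b (zip (u :: s) s) /\
    \sum_(x <- zip (u :: s) s) (x.2 - x.1) = v - u.
Proof.
elim: s a u => [|h s IH] a u au vb /=.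
  by move=> /itv_partition_nil ->; rewrite big_nil subrr.
move=> [/= /andP[uh hs] hv].
have hsv : itv_partition h v s by split.
have hv_le := itv_partition_le hsv.
have [seg s1] := IH h h (lexx h) vb hsv.
split; last by rewrite big_cons /= s1; ring.
have /(_ [:: (u, h)]) := @ordered_in_cat R a h b.
move=> /(_ (zip (h :: s) s)) -> //; [exact: le_trans (ltW uh)|exact: le_trans vb|].
by rewrite /ordered_in /= au lexx (ltW uh).
Qed.

Lemma absolutely_continuous_bounded_variation a b (f : R -> R) : a <= b ->
  absolutely_continuous a b f -> bounded_variation a b f.
Proof.
move=> ab fac; apply/bounded_variationP => //.
rewrite ge0_fin_numE ?total_variation_ge0 //.
have [d d0 H] := absolutely_continuous_seq fac (@ltr01 R).
pose P u v := u <= v -> (total_variation u v f < +oo)%E.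
suff : P a b by apply.
apply: cousin => //.
- by move=> u w v uw wv Puw Pwv _; rewrite (total_variationD _ uw wv) lte_add_pinfty ?Puw ?Pwv.
- move=> t tab; exists (d / 2); first by rewrite divr_gt0.
  move=> u v au ut tv vb tu vt uv.
  apply: (@le_lt_trans _ _ 1%:E); last exact: ltry.
  apply: ge_ereal_sup => _ /= [_ [s suv <-] <-]; rewrite lee_fin.
  have [so ss] := itv_partition_ordered au vb suv.
  have := H _ so; rewrite ss => /(_ _)/ltW; rewrite variation_zip // => h.
  have -> : \sum_(x <- zip s (u :: s)) `|f x.1 - f x.2| = \sum_(x <- zip (u :: s) s) `|f x.2 - f x.1|.
    elim: (s) (u) => [|y l IH] z /=; first by rewrite !big_nil.
    by rewrite !big_cons IH.
  apply: h; lra.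
Qed.

(** A monotone function has unbounded difference quotients only on a null set.
    For each slope M, the intervals on which W increases by more than M times
    their length form a Vitali cover of the set of steep points; a disjoint
    subfamily covers it up to a null set, and its total length is at most 1/M
    times the increment of W, because the Stieltjes measure of W is additive. *)
Lemma steep_negligible (W : cumulative R R) (a b : R) : a <= b ->
  lebesgue_measure.-negligible [set t | a <= t <= b /\ forall M d : R, 0 < d ->
    exists2 s, 0 < `|s - t| < d & M * `|s - t| < `|W s - W t|].
Proof.
move=> ab; set E := (X in _.-negligible X).
have Wnd x y : x <= y -> W x <= W y by move=> xy; exact: cumulative_is_nondecreasing.
apply/negligible_outer_measure.
set T := W (b + 1) - W (a - 1).
have T0 : 0 <= T by rewrite subr_ge0 Wnd //; lra.
suff EM (M : R) : 0 < M -> (lebesgue_measure E <= (T / M)%:E)%E.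
  apply/eqP; rewrite eq_le outer_measure_ge0 andbT; apply/lee_addgt0Pr => e e0.
  rewrite add0e; apply: (le_trans (EM ((T + 1) / e) _)); first by rewrite divr_gt0 // ltr_wpDl.
  rewrite lee_fin invf_div mulrA ler_pdivrMr ?ltr_wpDl // mulrC ler_wpM2l //; [exact: ltW|lra].
move=> M0.
(* the covering theorem wants a sequence of balls: those with rational end
   points, padded with a fixed ball outside the range of the enumeration *)
pose c n : rat * rat := odflt (0, 1) (unpickle n).
pose p n : R := ratr (c n).1; pose q n : R := ratr (c n).2.
pose B n : set R := if p n < q n then ball ((p n + q n) / 2) ((q n - p n) / 2) else ball 0 1.
pose D := [set n | [/\ p n < q n, a - 1 <= p n, q n <= b + 1 &
  M * (q n - p n) < W (q n) - W (p n)]].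
have Bball n : is_ball (B n) by rewrite /B; case: ifP => _; exact: is_ball_ball.
have rB n : p n < q n -> (radius (B n))%:num = (q n - p n) / 2.
  by move=> pq; rewrite /B pq radius_ball_num // divr_ge0 // subr_ge0 ltW.
have B0 n : 0 < (radius (B n))%:num.
  have [pq|pq] := boolP (p n < q n); first by rewrite rB // divr_gt0 // subr_gt0.
  by rewrite /B (negbTE pq) radius_ball_num.
have cB n : p n < q n -> closure (B n) = `[p n, q n]%classic.
  move=> pq; have r0 : 0 < (q n - p n) / 2 by rewrite divr_gt0 // subr_gt0.
  rewrite /B pq closure_ballE closed_ball_itv //.
  have -> : (p n + q n) / 2 - (q n - p n) / 2 = p n by field.
  by have -> : (p n + q n) / 2 + (q n - p n) / 2 = q n by field.
have cover : vitali_cover E B D.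
  split=> // x [/andP[ax xb] xE] e e0.
  have [|s /andP[s0 sd] sM] := xE M (Num.min (e / 2) (1/2)); first by rewrite lt_min !divr_gt0.
  rewrite lt_min in sd; case/andP: sd => sd1 sd2.
  pose lo := Num.min s x; pose hi := Num.max s x.
  have [lohi [lox xhi]] : hi - lo = `|s - x| /\ lo <= x /\ x <= hi.
    rewrite /hi /lo; case: (leP s x) => h; split; rewrite ?lexx ?h ?(ltW h) //.
      by rewrite ler0_norm ?subr_le0 // opprB.
    by rewrite ger0_norm // subr_ge0 ltW.
  have Wlohi : W hi - W lo = `|W s - W x|.
    rewrite /hi /lo; case: (leP s x) => h.
      by rewrite ler0_norm ?subr_le0 ?Wnd // opprB.
    by rewrite ger0_norm // subr_ge0 Wnd // ltW.
  rewrite -lohi -Wlohi in sM s0 sd1 sd2.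
  (* margin left for rational end points: W gains enough on [lo, hi] to keep
     slope M on an interval longer by 2 k *)
  pose k := Num.min (e / 4) (Num.min (1 / 2) (((W hi - W lo) / M - (hi - lo)) / 2)).
  have k0 : 0 < k.
    rewrite !lt_min !divr_gt0 //=.
    by rewrite subr_gt0 ltr_pdivlMr // mulrC.
  have k1 : k <= e / 4 by rewrite ge_min lexx.
  have k2 : k <= 1 / 2 by rewrite !ge_min lexx orbT.
  have k3 : k <= ((W hi - W lo) / M - (hi - lo)) / 2 by rewrite !ge_min lexx !orbT.
  have [r1] : exists r, ratr r \in `]lo - k, lo[ by apply: rat_in_itvoo; lra.
  have [r2] : exists r, ratr r \in `]hi, hi + k[ by apply: rat_in_itvoo; lra.
  rewrite !in_itv /= => /andP[h1 h2] /andP[h3 h4].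
  pose n := pickle (r1, r2).
  have pn : p n = ratr r1 by rewrite /p /c pickleK.
  have qn : q n = ratr r2 by rewrite /q /c pickleK.
  have pq : p n < q n by rewrite pn qn; lra.
  exists n; split.
  - split=> //; rewrite ?pn ?qn; [lra|lra|].
    have : (ratr r2 - ratr r1) < (W hi - W lo) / M by lra.
    rewrite ltr_pdivlMr // mulrC => /lt_le_trans; apply.
    by apply: lerB; apply: Wnd; exact: ltW.
  - rewrite /B pq /ball /= ltr_distlC pn qn; apply/andP; split; lra.
  - rewrite rB // pn qn; lra.
have [D' [_ D'D tD' E0]] := vitali_theorem B0 cover.
pose nu := lebesgue_stieltjes_measure W.
have nuE u v : u <= v -> nu `]u, v]%classic = (W v - W u)%:E.
  move=> uv; rewrite -(wlength_itv_bnd W false false uv).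
  rewrite /nu /lebesgue_stieltjes_measure /= /measure_extension /=.
  by rewrite measurable_mu_extE //; exact: is_ocitv.
have mcB n : D' n -> measurable (closure (B n)).
  by move=> /D'D[pq _ _ _]; rewrite cB //; exact: measurable_itv.
pose C := \bigcup_(k in D') closure (B k).
have mC : (lebesgue_measure C <= (T / M)%:E)%E.
  rewrite /C (measure_bigcup lebesgue_measure) //.
  apply: (@le_trans _ _ (\sum_(i <oo | i \in D') ((M^-1)%:E * nu `]p i, q i]%classic))%E).
    apply: lee_nneseries => // i; rewrite inE => iD'.
    have [pq _ _ h] := D'D _ iD'.
    rewrite cB // [leLHS]lebesgue_measure_itv /= lte_fin pq (nuE _ _ (ltW pq)).
    rewrite -EFinB -EFinM lee_fin.
    by rewrite mulrC ler_pdivlMr // mulrC ltW.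
  rewrite nneseriesZl; last by move=> *; exact: measure_ge0.
  rewrite -(measure_bigcup nu) //; last first.
  - move=> i j iD' jD' [x [/= xi xj]]; apply: tD' => //; exists x.
    have [pqi _ _ _] := D'D _ iD'; have [pqj _ _ _] := D'D _ jD'.
    by rewrite /= !cB //; split; exact: subset_itv_oc_cc.
  rewrite [T / M]mulrC EFinM lee_pmul2l //; last by rewrite lte_fin invr_gt0.
  rewrite -nuE; last lra.
  apply: le_measure; rewrite ?inE.
  - by apply: bigcup_measurable => i _; exact: measurable_itv.
  - exact: measurable_itv.
  - move=> x [i iD'] /=; have [pq ap qb _] := D'D _ iD'; rewrite !in_itv /= => /andP[px xq].
    by rewrite (le_lt_trans ap) // (le_trans xq).
apply: (@le_trans _ _ (lebesgue_measure (E `\` C) + lebesgue_measure C)%E); last by rewrite E0 add0e.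
apply: (@le_trans _ _ (lebesgue_measure ((E `\` C) `|` C))%E).
  by apply: le_outer_measure => x Ex; have [?|?] := pselect (C x); [right|left].
exact: outer_measureU2.
Qed.

Lemma continuous_total_variation_clamp a b (f : R -> R) : a < b ->
  absolutely_continuous a b f ->
  continuous (fun t => fine (total_variation a (clamp a b t) f)).
Proof.
move=> ab fac; apply: (continuous_comp_clamp (f := fine \o total_variation a ^~ f) (ltW ab)).
apply: total_variation_continuous => //.
  exact: absolutely_continuous_continuous.
by apply: absolutely_continuous_bounded_variation => //; exact: ltW.
Qed.

Lemma total_variation_clamp_increment a b (f : R -> R) (s t : R) : a < b ->
  absolutely_continuous a b f -> s <= t ->
  `|f (clamp a b t) - f (clamp a b s)| <=
  fine (total_variation a (clamp a b t) f) - fine (total_variation a (clamp a b s) f).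
Proof.
move=> ab fac st.
have [/andP[as_ sb] /andP[at_ tb]] := (clamp_itv s (ltW ab), clamp_itv t (ltW ab)).
have cst := clamp_mono a b st.
have bv := absolutely_continuous_bounded_variation (ltW ab) fac.
have fs : total_variation a (clamp a b s) f \is a fin_num.
  by apply/bounded_variationP => //; exact: bounded_variationl bv.
have ft : total_variation (clamp a b s) (clamp a b t) f \is a fin_num.
  apply/bounded_variationP => //; apply: (@bounded_variationr _ a) => //.
  exact: bounded_variationl bv.
rewrite (total_variationD f as_ cst) fineD // addrAC subrr add0r.
by rewrite -lee_fin fineK //; exact: total_variation_ge.
Qed.

(** Everything that is needed of the variation of f.  Clamping makes it a
    monotone continuous function on the whole line, which has a Stieltjes
    measure. *)
Lemma absolutely_continuous_variation_bound a b (f : R -> R) : a < b ->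
  absolutely_continuous a b f ->
  exists V : R -> R, [/\ {homo V : x y / x <= y},
    (forall s t, a <= s -> s <= t -> t <= b -> `|f t - f s| <= V t - V s) &
    lebesgue_measure.-negligible [set t | a <= t <= b /\ forall M d : R, 0 < d ->
      exists2 s, 0 < `|s - t| < d & M * `|s - t| < `|V s - V t|]].
Proof.
move=> ab fac.
pose V t := fine (total_variation a (clamp a b t) f).
have Vnd : {homo V : x y / x <= y}.
  move=> x y xy; rewrite -subr_ge0.
  exact: le_trans (total_variation_clamp_increment ab fac xy).
have Vc : right_continuous V.
  by apply: right_continuousW; exact: continuous_total_variation_clamp.
pose m := isCumulative.Build R _ R V Vnd Vc.
pose W : cumulative R R := HB.pack V m.
exists V; split=> //.
- move=> s t as_ st tb; have := total_variation_clamp_increment ab fac st.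
  have Et : clamp a b t = t by apply: clamp_id; rewrite tb (le_trans as_).
  have Es : clamp a b s = s by apply: clamp_id; rewrite as_ (le_trans st).
  by rewrite /V Et Es.
- exact: (@steep_negligible W a b (ltW ab)).
Qed.

End Variation.

(** * Growth controlled by the variation of another function *)

Section GrowthByVariation.
Context {R : realType}.

Lemma has_derivative_onP (V : normedModType R) (a b t : R) (f : R -> V) (l : V) :
  has_derivative_on a b f t l <-> forall e, 0 < e -> exists2 d, 0 < d &
    forall s, a <= s <= b -> `|s - t| < d ->
      `|f s - f t - (s - t) *: l| <= e * `|s - t|.
Proof.
have E s : s != t -> l - (s - t)^-1 *: (f s - f t) =
    - ((s - t)^-1 *: (f s - f t - (s - t) *: l)).
  move=> st; rewrite [in RHS]scalerBr scalerA mulVf ?subr_eq0 // scale1r.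
  by rewrite opprB.
split.
- move=> /cvgrPdist_le H e e0; have := H e e0.
  rewrite near_withinE => /nbhs_ballP[d /= d0 Hd]; exists d => // s sab st.
  have [->|st'] := eqVneq s t; first by rewrite !subrr scale0r subrr !normr0 mulr0.
  have := Hd s; rewrite /ball /= distrC => /(_ st st').
  rewrite in_itv /= => /(_ sab); rewrite E // normrN normrZ normfV.
  by rewrite mulrC ler_pdivrMr // normr_gt0 subr_eq0.
- move=> H; apply/cvgrPdist_le => e e0; have [d d0 Hd] := H e e0.
  rewrite near_withinE; apply/nbhs_ballP; exists d => //= s st st'.
  rewrite in_itv /= => sab; rewrite E // normrN normrZ normfV.
  rewrite mulrC ler_pdivrMr ?normr_gt0 ?subr_eq0 //.
  by apply: Hd => //; rewrite distrC.
Qed.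

Lemma is_deriveP (V : normedModType R) (f : R -> V) (t : R) l :
  is_derive t 1 f l <-> forall e, 0 < e -> exists2 d, 0 < d &
    forall s, `|s - t| < d -> `|f s - f t - (s - t) *: l| <= e * `|s - t|.
Proof.
have tt : t \in `]t - 1, t + 1[ by rewrite in_itv /=; apply/andP; split; lra.
rewrite -(has_derivative_on_is_derive _ _ tt) has_derivative_onP; split=> H e e0.
- have [d d0 Hd] := H e e0; exists (Num.min d 1); first by rewrite lt_min d0 ltr01.
  move=> s; rewrite lt_min => /andP[sd s1]; apply: Hd => //.
  by move: s1; rewrite ltr_distl => /andP[? ?]; rewrite !ltW.
- by have [d d0 Hd] := H e e0; exists d => // s _; exact: Hd.
Qed.

Lemma absolutely_continuousS (V : normedModType R) a b p q (f : R -> V) :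
  a <= p -> q <= b -> absolutely_continuous a b f -> absolutely_continuous p q f.
Proof.
move=> ap qb H e /H[d d0 Hd]; exists d => // n u v uv; apply: Hd => i.
have [pu [uv' vq]] := uv i; split; first exact: le_trans pu.
by split=> //; exact: le_trans qb.
Qed.

Lemma absolutely_continuous_id a b : absolutely_continuous a b (@id R).
Proof.
move=> e e0; exists e => // n u v uv _; apply: le_lt_trans.
by apply: ler_sum => i _; have [_ [h _]] := uv i; rewrite /= ger0_norm // subr_ge0.
Qed.

Lemma absolutely_continuousD (V : normedModType R) a b (f g : R -> V) :
  absolutely_continuous a b f -> absolutely_continuous a b g ->
  absolutely_continuous a b (fun t => f t + g t).
Proof.
apply: (@absolutely_continuous_lip R V V V a b f g _ 1) => u v _ _ _.
rewrite mul1r; apply: le_trans (ler_normD _ _).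
by rewrite opprD addrACA.
Qed.

Lemma absolutely_continuousN (V : normedModType R) a b (f : R -> V) :
  absolutely_continuous a b f -> absolutely_continuous a b (fun t => - f t).
Proof.
move=> fac; apply: (absolutely_continuous_lip (L := 1) _ fac fac) => u v _ _ _.
by rewrite -opprD normrN mul1r lerDl.
Qed.

Lemma absolutely_continuous_cst (V : normedModType R) a b (c : V) :
  absolutely_continuous a b (fun=> c).
Proof.
have := @absolutely_continuous_id a b.
move=> h; apply: (absolutely_continuous_lip (L := 0) _ h h) => u v _ _ _.
by rewrite subrr normr0 mul0r.
Qed.

Lemma absolutely_continuousM a b (f g : R -> R) :
  absolutely_continuous a b f -> absolutely_continuous a b g ->
  absolutely_continuous a b (fun t => f t * g t).
Proof.
have bnd (h : R -> R) : absolutely_continuous a b h ->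
    exists B, forall t, a <= t -> t <= b -> `|h t| <= B.
  move=> hac; have [ab|ba] := ltP a b; last first.
    exists `|h a| => t at_ tb; have -> // : t = a.
    by apply/eqP; rewrite eq_le at_ (le_trans tb ba).
  have [V [Vnd hV _]] := absolutely_continuous_variation_bound ab hac.
  exists (`|h a| + (V b - V a)) => t at_ tb.
  rewrite -[h t](subrK (h a)) addrC; apply: (le_trans (ler_normD _ _)); rewrite lerD2l.
  by apply: (le_trans (hV _ _ (lexx a) at_ tb)); rewrite lerB // Vnd.
move=> fac gac; have [[B fB] [C gC]] := (bnd _ fac, bnd _ gac).
apply: (absolutely_continuous_lip (L := `|B| + `|C|) _ fac gac) => u v au uv vb.
have -> : f v * g v - f u * g u = (f v - f u) * g v + f u * (g v - g u) by ring.
apply: (le_trans (ler_normD _ _)); rewrite !normrM mulrDr lerD //.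
  rewrite mulrC ler_wpM2r // (le_trans (gC v (le_trans au uv) vb)) //.
  by rewrite (le_trans (ler_norm C)) // lerDr.
rewrite ler_wpM2r // (le_trans (fB u au (le_trans uv vb))) //.
by rewrite (le_trans (ler_norm B)) // lerDl.
Qed.

(** The discrete form of the bound of |F b - F a| by the integral of
    al |f'| + be over [a, b], with the increment of V in place of the
    integral of |f'|: where f is differentiable, |f'| is at most the growth
    rate of V. *)
Lemma growth_by_variation (a b : R) (F f V : R -> R) (N : set R) (al be : R) : a <= b ->
  0 <= al -> 0 <= be ->
  absolutely_continuous a b F -> {homo V : x y / x <= y} ->
  (forall s t, a <= s -> s <= t -> t <= b -> `|f t - f s| <= V t - V s) ->
  lebesgue_measure.-negligible N ->
  (forall t, a <= t <= b -> ~ N t -> exists l u,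
     [/\ is_derive t 1 F l, is_derive t 1 f u & `|l| <= al * `|u| + be]) ->
  `|F b - F a| <= al * (V b - V a) + be * (b - a).
Proof.
move=> ab al0 be0 Fac Vnd fV N0 HF.
pose W t := al * V t + be * t.
have Wnd x y : x <= y -> W x <= W y by move=> xy; rewrite lerD // ler_wpM2l // Vnd.
have -> : al * (V b - V a) + be * (b - a) = W b - W a by rewrite /W; ring.
apply: (absolutely_continuous_growth ab Fac _ N0) => [x y _ _|]; first exact: Wnd.
move=> t tab Nt e e0; have [l [u [Fl fu lu]]] := HF t tab Nt.
(* the errors of F and of f contribute e' and al e' *)
pose e' := e / (1 + al); have al1 : 0 < 1 + al by rewrite ltr_pwDl.
have e'0 : 0 < e' by rewrite divr_gt0.
have [d1 d10 H1] := (is_deriveP _ _ _).1 Fl e' e'0.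
have [d2 d20 H2] := (is_deriveP _ _ _).1 fu e' e'0.
exists (Num.min d1 d2); first by rewrite lt_min d10.
move=> s sab; rewrite lt_min => /andP[/H1 {}H1 /H2 {}H2].
set h := `|s - t| in H1 H2 *.
have fV' : `|f s - f t| <= `|V s - V t|.
  have [st|/ltW ts] := leP s t.
    rewrite distrC (distrC (V s)) (ger0_norm (x := V t - V s)) ?subr_ge0 ?Vnd //; apply: fV => //.
      by case/andP: sab.
    by case/andP: tab.
  rewrite (ger0_norm (x := V s - V t)) ?subr_ge0 ?Vnd //; apply: fV => //.
    by case/andP: tab.
  by case/andP: sab.
have WV : `|W s - W t| = al * `|V s - V t| + be * h.
  rewrite /h; have [st|/ltW ts] := leP s t.
    rewrite !ler0_norm ?subr_le0 ?Vnd ?Wnd // /W; ring.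
  rewrite !ger0_norm ?subr_ge0 ?Vnd ?Wnd // /W; ring.
have h0 : 0 <= h by exact: normr_ge0.
have l1 : `|F s - F t| <= h * `|l| + e' * h.
  rewrite -[F s - F t](subrK ((s - t) *: l)) addrC.
  by apply: (le_trans (ler_normD _ _)); rewrite normrZ lerD.
have l2 : h * `|u| <= `|V s - V t| + e' * h.
  rewrite -normrZ -[(s - t) *: u](subrK (f s - f t)) addrC.
  by apply: (le_trans (ler_normD _ _)); rewrite lerD // distrC.
have l3 : h * `|l| <= al * (h * `|u|) + be * h.
  by have := ler_wpM2l h0 lu; rewrite mulrDr mulrCA [h * be]mulrC.
have l4 : al * (h * `|u|) <= al * (`|V s - V t| + e' * h) by rewrite ler_wpM2l.
have l5 : e * h = e' * h * (1 + al) by rewrite /e'; field; exact: lt0r_neq0.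
rewrite WV l5; lra.
Qed.

End GrowthByVariation.

(** * Expansions of a horizontal curve at almost every time *)

Section PointwiseDerive.
Context {R : realType}.
Implicit Types (f g : R -> R) (t : R).

Lemma is_derive_fun_cst t c : is_derive t 1 (fun=> c : R) 0.
Proof. exact: is_derive_cst. Qed.

Lemma is_derive_fun_id t : is_derive t 1 (fun x : R => x) 1.
Proof. exact: is_derive_id. Qed.

Lemma is_derive_funD f g t df dg : is_derive t 1 f df -> is_derive t 1 g dg ->
  is_derive t 1 (fun x => f x + g x) (df + dg).
Proof. by move=> hf hg; exact: (is_deriveD hf hg). Qed.

Lemma is_derive_funN f t df : is_derive t 1 f df ->
  is_derive t 1 (fun x => - f x) (- df).
Proof. by move=> hf; exact: (is_deriveN hf). Qed.

Lemma is_derive_funM f g t df dg : is_derive t 1 f df -> is_derive t 1 g dg ->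
  is_derive t 1 (fun x => f x * g x) (f t * dg + g t * df).
Proof. by move=> hf hg; exact: (is_deriveM hf hg). Qed.

Lemma is_derive_funX f n t df : is_derive t 1 f df ->
  is_derive t 1 (fun x => f x ^+ n.+1) (n.+1%:R * f t ^+ n * df).
Proof.
move=> hf; have -> : (fun x => f x ^+ n.+1) = f ^+ n.+1.
  by apply/funext => x; rewrite exprfctE.
exact: (is_deriveX n.+1 hf).
Qed.

End PointwiseDerive.

(** Differentiates an arithmetic expression in functions whose derivatives are
    hypotheses.  The goal has to be matched up to abstraction of the variable,
    which instance resolution does not do. *)
Ltac derive_rules := lazymatch goal with
  | |- is_derive _ _ (fun x => x) _ => exact: is_derive_fun_id
  | |- is_derive _ _ (fun _ => ?c) _ => exact: is_derive_fun_cst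
  | |- is_derive _ _ (fun x => @?f x + @?g x) _ => eapply is_derive_funD; derive_rules
  | |- is_derive _ _ (fun x => - @?f x) _ => eapply is_derive_funN; derive_rules
  | |- is_derive _ _ (fun x => @?f x * @?g x) _ => eapply is_derive_funM; derive_rules
  | |- is_derive _ _ (fun x => @?f x ^+ _) _ => eapply is_derive_funX; derive_rules
  | |- _ => eassumption
  end.

Ltac derive_ring := eapply is_derive_eq; [derive_rules | try (rewrite /=; field)].

Section Expansion.
Context {R : realType}.
Variables (a b : R) (x1 x2 x3 x4 u1 u2 V : R -> R) (N : set R) (t : R).
Hypothesis x2_ac : absolutely_continuous a b x2.
Hypothesis x3_ac : absolutely_continuous a b x3.
Hypothesis x4_ac : absolutely_continuous a b x4.
Hypothesis V_nd : {homo V : x y / x <= y}.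
Hypothesis V_x2 : forall s r, a <= s -> s <= r -> r <= b -> `|x2 r - x2 s| <= V r - V s.
Hypothesis N0 : lebesgue_measure.-negligible N.
Hypothesis x1_der : forall s, a <= s <= b -> ~ N s -> is_derive s 1 x1 (u1 s).
Hypothesis x2_der : forall s, a <= s <= b -> ~ N s -> is_derive s 1 x2 (u2 s).
Hypothesis x3_der : forall s, a <= s <= b -> ~ N s -> is_derive s 1 x3 (x1 s * u2 s).
Hypothesis x4_der : forall s, a <= s <= b -> ~ N s -> is_derive s 1 x4 (x1 s ^+ 2 / 2 * u2 s).
Hypothesis t_ab : a <= t <= b.
Hypothesis Nt : ~ N t.
Variables M d0 : R.
Hypothesis d0_gt0 : 0 < d0.
Hypothesis V_steep : forall s, 0 < `|s - t| < d0 -> `|V s - V t| <= M * `|s - t|.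

Let M_ge0 : 0 <= M.
Proof.
have : `|V (t + d0 / 2) - V t| <= M * `|t + d0 / 2 - t|.
  by apply: V_steep; rewrite addrAC subrr add0r gtr0_norm ?divr_gt0 //= ltr_pdivrMr // ltr_pMr // ltr1n.
rewrite [t + _]addrC addrK (gtr0_norm (x := d0 / 2)) ?divr_gt0 // => hM; have := le_trans (normr_ge0 _) hM.
by rewrite pmulr_lge0 // divr_gt0.
Qed.

(** growth_by_variation between t and a nearby point, on either side of t, where
    V has slope at most M. *)
Lemma growth_near (F : R -> R) (s al be : R) : a <= s <= b -> `|s - t| < d0 ->
  0 <= al -> 0 <= be -> absolutely_continuous a b F ->
  (forall r, a <= r <= b -> `|r - t| <= `|s - t| -> ~ N r -> exists2 l,
     is_derive r 1 F l & `|l| <= al * `|u2 r| + be) ->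
  `|F s - F t| <= (al * M + be) * `|s - t|.
Proof.
move=> /andP[as_ sb] sd al0 be0 Fac HF; case/andP: t_ab => at_ tb.
have [->|st] := eqVneq s t; first by rewrite !subrr normr0 mulr0.
have Vst : `|V s - V t| <= M * `|s - t|.
  by apply: V_steep; rewrite sd andbT normr_gt0 subr_eq0.
apply: (@le_trans _ _ (al * `|V s - V t| + be * `|s - t|)); last first.
  by rewrite mulrDl lerD2r -mulrA ler_wpM2l.
have G p q : a <= p -> p <= q -> q <= b ->
    (forall r, p <= r <= q -> `|r - t| <= `|s - t|) ->
    `|F q - F p| <= al * (V q - V p) + be * (q - p).
  move=> ap pq qb pqt; apply: (growth_by_variation (f := x2) pq al0 be0 _ V_nd _ N0) => //.
  - exact: absolutely_continuousS Fac.
  - by move=> r r' pr rr' r'q; apply: V_x2 => //; [exact: le_trans pr|exact: le_trans qb].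
  - move=> r prq Nr; have rab : a <= r <= b.
      by case/andP: prq => pr rq; rewrite (le_trans ap pr) (le_trans rq qb).
    have [l Fl lb] := HF r rab (pqt r prq) Nr.
    by exists l, (u2 r); split=> //; exact: x2_der.
have [ts|st'] := ltP t s.
  rewrite (ger0_norm (x := V s - V t)) ?subr_ge0 ?V_nd ?(ltW ts) //.
  rewrite (ger0_norm (x := s - t)) ?subr_ge0 ?(ltW ts) //; apply: G => //; first exact: ltW.
  by move=> r /andP[tr rs]; rewrite !ger0_norm ?subr_ge0 ?(ltW ts) // lerB.
rewrite distrC (distrC (V s)) (distrC s).
rewrite (ger0_norm (x := V t - V s)) ?subr_ge0 ?V_nd //.
rewrite (ger0_norm (x := t - s)) ?subr_ge0 //; apply: G => //.
move=> r /andP[tr rs]; rewrite distrC (distrC s) !ger0_norm ?subr_ge0 //.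
by rewrite lerB.
Qed.

(** The function F below has at r the derivative
      (x1(r) - x1(t) - u1(t) (r-t)) u2(r) - u1(t) (x2(r) - x2(t) - u2(t) (r-t)).
    Both brackets are o(|r - t|); the factor u2(r) is not bounded, but its
    integral is, by the variation of x2. *)
Lemma second_order_expansion e : 0 < e -> exists2 d, 0 < d & forall s,
  a <= s <= b -> `|s - t| < d ->
  `|x3 s - x3 t - x1 t * (x2 s - x2 t) - u1 t * u2 t / 2 * (s - t) ^+ 2|
    <= e * `|s - t| ^+ 2.
Proof.
move=> e0; set v1 := u1 t; set v2 := u2 t.
pose C := M + `|v1| + `|v1| + 1.
have v10 : 0 <= `|v1| by exact: normr_ge0.
have C0 : 0 < C by rewrite /C; have := M_ge0; lra.
have [eta eta0 etaC] : exists2 eta, 0 < eta & eta * C = e.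
  by exists (e / C); rewrite ?divr_gt0 // divfK // gt_eqF.
have [d1 d10 H1] := (is_deriveP _ _ _).1 (x1_der t_ab Nt) _ eta0.
have [d2 d20 H2] := (is_deriveP _ _ _).1 (x2_der t_ab Nt) _ eta0.
exists (Num.min d0 (Num.min d1 d2)); first by rewrite !lt_min d0_gt0 d10.
move=> s sab; rewrite !lt_min => /and3P[sd0 sd1 sd2]; set h := `|s - t|.
have h0 : 0 <= h by exact: normr_ge0.
pose F r := x3 r - x1 t * x2 r - v1 * ((r - t) * (x2 r - x2 t)) + v1 * v2 * (r - t) ^+ 2 / 2.
have Fac : absolutely_continuous a b F.
  have rt : absolutely_continuous a b (fun r : R => r - t).
    by apply: absolutely_continuousD; [exact: absolutely_continuous_id|exact: absolutely_continuous_cst].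
  have c := @absolutely_continuous_cst R R a b.
  apply: absolutely_continuousD; first (apply: absolutely_continuousD; first apply: absolutely_continuousD => //).
  - by apply: absolutely_continuousN; apply: absolutely_continuousM.
  - apply: absolutely_continuousN; apply: absolutely_continuousM => //.
    by apply: absolutely_continuousM => //; apply: absolutely_continuousD.
  - apply: absolutely_continuousM => //; apply: absolutely_continuousM => //.
    exact: absolutely_continuousM.
have FE : `|F s - F t| <= (eta * h * M + `|v1| * (eta * h)) * h.
  apply: growth_near => //; rewrite ?mulr_ge0 ?(ltW eta0) //.
  move=> r rab rs Nr; have D2 := x2_der rab Nr; have D3 := x3_der rab Nr.
  exists ((x1 r - x1 t - (r - t) * v1) * u2 r - v1 * (x2 r - x2 t - (r - t) * v2)).
    by rewrite /F; derive_ring.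
  have /H1 {}H1 : `|r - t| < d1 by exact: le_lt_trans sd1.
  have /H2 {}H2 : `|r - t| < d2 by exact: le_lt_trans sd2.
  apply: (le_trans (ler_normB _ _)); rewrite !normrM lerD //.
    by rewrite ler_wpM2r // (le_trans H1) // ler_wpM2l // ltW.
  by rewrite ler_wpM2l // (le_trans H2) // ler_wpM2l // ltW.
have {}H2 := H2 s sd2.
have -> : x3 s - x3 t - x1 t * (x2 s - x2 t) - v1 * v2 / 2 * (s - t) ^+ 2 =
  (F s - F t) + v1 * (s - t) * (x2 s - x2 t - (s - t) * v2) by rewrite /F; field.
apply: (le_trans (ler_normD _ _)); rewrite normrM normrM -/h.
have : `|v1| * h * `|x2 s - x2 t - (s - t) * v2| <= `|v1| * h * (eta * h).
  by rewrite ler_wpM2l // mulr_ge0.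
move=> /(lerD FE) /le_trans; apply.
rewrite -etaC.
have : 0 <= eta * h ^+ 2 by rewrite mulr_ge0 ?exprn_ge0 // ltW.
move=> H; rewrite -subr_ge0; suff -> : eta * C * h ^+ 2 -
  ((eta * h * M + `|v1| * (eta * h)) * h + `|v1| * h * (eta * h)) = eta * h ^+ 2 by [].
by rewrite /C; ring.
Qed.

(** As for second order; the first term of the derivative of F is now
    half the difference of (x1 - x1(t))^2 and (u1 (r-t))^2, times u2(r), whose
    first factor is o(|r - t|^2). *)
Lemma third_order_expansion e : 0 < e -> exists2 d, 0 < d & forall s,
  a <= s <= b -> `|s - t| < d ->
  `|x4 s - x4 t - x1 t * (x3 s - x3 t) + x1 t ^+ 2 / 2 * (x2 s - x2 t)
     - u1 t ^+ 2 * u2 t / 6 * (s - t) ^+ 3| <= e * `|s - t| ^+ 3.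
Proof.
move=> e0; set v1 := u1 t; set v2 := u2 t.
pose C := (2 * `|v1| + 1) * M + 2 * `|v1| ^+ 2 + 1.
have v10 : 0 <= `|v1| by exact: normr_ge0.
have C0 : 0 < C.
  by rewrite ltr_wpDl // addr_ge0 ?mulr_ge0 ?exprn_ge0 // addr_ge0 // mulr_ge0.
have [eta [eta0 eta1 etaC]] : exists eta, [/\ 0 < eta, eta <= 1 & eta * C <= e].
  exists (Num.min 1 (e / C)); split; first by rewrite lt_min ltr01 divr_gt0.
    by rewrite ge_min lexx.
  by rewrite -ler_pdivlMr // ge_min lexx orbT.
have [d1 d10 H1] := (is_deriveP _ _ _).1 (x1_der t_ab Nt) _ eta0.
have [d2 d20 H2] := (is_deriveP _ _ _).1 (x2_der t_ab Nt) _ eta0.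
exists (Num.min d0 (Num.min d1 d2)); first by rewrite !lt_min d0_gt0 d10.
move=> s sab; rewrite !lt_min => /and3P[sd0 sd1 sd2]; set h := `|s - t|.
have h0 : 0 <= h by exact: normr_ge0.
pose F r := x4 r - x1 t * x3 r + x1 t ^+ 2 / 2 * x2 r
  - v1 ^+ 2 / 2 * ((r - t) ^+ 2 * (x2 r - x2 t)) + v1 ^+ 2 * v2 / 3 * (r - t) ^+ 3.
have Fac : absolutely_continuous a b F.
  have rt : absolutely_continuous a b (fun r : R => r - t).
    by apply: absolutely_continuousD; [exact: absolutely_continuous_id|exact: absolutely_continuous_cst].
  have c := @absolutely_continuous_cst R R a b.
  have rt2 : absolutely_continuous a b (fun r : R => (r - t) ^+ 2) by exact: absolutely_continuousM.
  have rt3 : absolutely_continuous a b (fun r : R => (r - t) ^+ 3) by exact: absolutely_continuousM.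
  apply: absolutely_continuousD; first (apply: absolutely_continuousD;
    first (apply: absolutely_continuousD; first apply: absolutely_continuousD => //)).
  - by apply: absolutely_continuousN; apply: absolutely_continuousM.
  - exact: absolutely_continuousM.
  - apply: absolutely_continuousN; apply: absolutely_continuousM => //.
    by apply: absolutely_continuousM => //; apply: absolutely_continuousD.
  - exact: absolutely_continuousM.
have FE : `|F s - F t| <= (eta * h * ((2 * `|v1| + 1) * h) * M + `|v1| ^+ 2 * h * (eta * h)) * h.
  apply: growth_near => //; rewrite ?mulr_ge0 ?exprn_ge0 ?(ltW eta0) // ?addr_ge0 ?mulr_ge0 //.
  move=> r rab rs Nr; have D2 := x2_der rab Nr; have D3 := x3_der rab Nr; have D4 := x4_der rab Nr.
  pose y := x1 r - x1 t - (r - t) * v1.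
  exists (y * (y + 2 * (r - t) * v1) / 2 * u2 r
    - v1 ^+ 2 * (r - t) * (x2 r - x2 t - (r - t) * v2)).
    by rewrite /F /y; derive_ring.
  have H1r : `|y| <= eta * `|r - t| by apply: H1; exact: le_lt_trans sd1.
  have /H2 {}H2 : `|r - t| < d2 by exact: le_lt_trans sd2.
  rewrite -/h in rs; have r0 := normr_ge0 (r - t).
  have y1 : `|y| <= eta * h by rewrite (le_trans H1r) // ler_wpM2l // ltW.
  have y2 : `|y + 2 * (r - t) * v1| / 2 <= (2 * `|v1| + 1) * h.
    rewrite ler_pdivrMr //; apply: (le_trans (ler_normD _ _)); rewrite !normrM (ger0_norm (x := 2)) //.
    have q1 : eta * h <= h by rewrite ler_piMl.
    have q2 : `|r - t| * `|v1| <= h * `|v1| by rewrite ler_wpM2r.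
    have q3 : 0 <= h * `|v1| by rewrite mulr_ge0.
    lra.
  apply: (le_trans (ler_normB _ _)); rewrite !normrM lerD //.
    rewrite ler_wpM2r // normfV (ger0_norm (x := 2)) // -[leLHS]mulrA ler_pM // divr_ge0.
  rewrite expr2; apply: ler_pM => //.
    by rewrite ler_wpM2l // mulr_ge0.
  by rewrite (le_trans H2) // ler_wpM2l // ltW.
have {}H2 := H2 s sd2.
have -> : x4 s - x4 t - x1 t * (x3 s - x3 t) + x1 t ^+ 2 / 2 * (x2 s - x2 t)
     - v1 ^+ 2 * v2 / 6 * (s - t) ^+ 3 =
  (F s - F t) + v1 ^+ 2 / 2 * (s - t) ^+ 2 * (x2 s - x2 t - (s - t) * v2) by rewrite /F; field.
apply: (le_trans (ler_normD _ _)); rewrite !normrM normfV (ger0_norm (x := 2)) // -/h.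
have : `|v1| ^+ 2 / 2 * h ^+ 2 * `|x2 s - x2 t - (s - t) * v2| <= `|v1| ^+ 2 / 2 * h ^+ 2 * (eta * h).
  by rewrite ler_wpM2l // !mulr_ge0 ?exprn_ge0.
move=> /(lerD FE) /le_trans; apply.
apply: (@le_trans _ _ (eta * C * h ^+ 3)); last by rewrite ler_wpM2r ?exprn_ge0.
rewrite -subr_ge0.
have -> : eta * C * h ^+ 3 - ((eta * h * ((2 * `|v1| + 1) * h) * M + `|v1| ^+ 2 * h * (eta * h)) * h
    + `|v1| ^+ 2 / 2 * h ^+ 2 * (eta * h)) = eta * h ^+ 3 * (`|v1| ^+ 2 / 2 + 1).
  by rewrite /C; field.
by rewrite !mulr_ge0 ?exprn_ge0 ?addr_ge0 ?mulr_ge0 ?exprn_ge0 // ltW.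
Qed.

End Expansion.

(** * Uniform limits off a set of small measure *)

Section Uniform.
Context {R : realType}.
Notation mu := (@lebesgue_measure R).

(** Egorov's theorem for a limit along a continuous parameter.  The set F m n
    below, on which the quotients at scale 1/n agree up to 1/m, is closed
    because each Q ^~ s is continuous; this takes the place of the measurability
    of suprema over s. *)
Lemma uniform_limit_off_small_set (a b : R) (Q : R -> R -> R) (l : R -> R) (N : set R) (eps : R) :
  0 < eps ->
  (forall s t, s != t -> {for t, continuous (Q ^~ s)}) ->
  mu.-negligible N ->
  (forall t, a <= t <= b -> ~ N t -> forall e, 0 < e -> exists2 d, 0 < d &
     forall s, a <= s <= b -> 0 < `|s - t| < d -> `|Q t s - l t| <= e) ->
  exists K : set R, [/\ closed K, K `<=` `[a, b]%classic,
    (mu (`[a, b]%classic `\` K) <= eps%:E)%E &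
    forall e, 0 < e -> exists2 d, 0 < d & forall t s, K t -> ~ N t -> a <= s <= b ->
      0 < `|s - t| < d -> `|Q t s - l t| <= e].
Proof.
move=> eps0 Qc N0 Ql.
pose F m n := [set t | a <= t <= b /\ forall s r, a <= s <= b -> a <= r <= b ->
  0 < `|s - t| < n.+1%:R^-1 -> 0 < `|r - t| < n.+1%:R^-1 ->
  `|Q t s - Q t r| <= m.+1%:R^-1].
have cF m n : closed (F m n).
  have -> : F m n = `[a, b]%classic `&` \bigcap_(s in `[a, b]%classic) \bigcap_(r in `[a, b]%classic)
      [set t | 0 < `|s - t| < n.+1%:R^-1 -> 0 < `|r - t| < n.+1%:R^-1 -> `|Q t s - Q t r| <= m.+1%:R^-1].
    apply/seteqP; split => [t [tab H]|t [tab H]].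
      split; rewrite /= ?in_itv // => s /=; rewrite in_itv /= => sab r /=.
      by rewrite in_itv /= => rab; exact: H.
    rewrite /= in_itv in tab; split => // s r sab rab.
    by apply: H; rewrite /= in_itv.
  apply: closedI; first exact: interval_closed.
  apply: closed_bigI => s _; apply: closed_bigI => r _.
  rewrite -[X in closed X]setCK; apply: open_closedC; rewrite openE => t /=.
  move/not_implyP => [ht] /not_implyP[hr]; move/negP; rewrite -ltNge => hlt.
  have near_dist v : 0 < `|v - t| < n.+1%:R^-1 -> \forall t' \near t, 0 < `|v - t'| < n.+1%:R^-1.
    move=> hv; have : (fun t' => `|v - t'|) @ t --> `|v - t|.
      by apply: cvg_norm; apply: cvgB; [exact: cvg_cst|exact: cvg_id].
    by move=> /(_ `]0, n.+1%:R^-1[%classic); apply; apply: near_in_itvoo; rewrite in_itv.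
  have neq v : 0 < `|v - t| < n.+1%:R^-1 -> v != t.
    by move=> /andP[]; rewrite normr_gt0 subr_eq0.
  have nQ : \forall t' \near t, m.+1%:R^-1 < `|Q t' s - Q t' r|.
    have : (fun t' => `|Q t' s - Q t' r|) @ t --> `|Q t s - Q t r|.
      by apply: cvg_norm; apply: cvgB; apply: Qc; exact: neq.
    by move=> /cvgr_gt; apply.
  have := near_dist s ht; have := near_dist r hr; move: nQ.
  apply: filterS3 => t' h1 h2 h3 /= H; have := H h3 h2.
  by rewrite leNgt h1.
have Fnd m : {homo F m : n k / (n <= k)%N >-> (n <= k)%O}.
  move=> n k nk; apply/subsetPset => t [tab H]; split => // s r sab rab /andP[s0 sn] /andP[r0 rn].
  have kn : (k.+1%:R^-1 : R) <= n.+1%:R^-1 by rewrite lef_pV2 ?posrE ?ltr0n // ler_nat ltnS.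
  by apply: H => //; apply/andP; split => //; exact: lt_le_trans kn.
have FN m : `[a, b]%classic `\` N `<=` \bigcup_n F m n.
  move=> t [/=]; rewrite in_itv /= => tab Nt.
  have [|d d0 H] := Ql t tab Nt (m.+1%:R^-1 / 2); first by rewrite divr_gt0 ?invr_gt0 ?ltr0n.
  near \oo => n; have nd : n.+1%:R^-1 < d by near: n; exact: near_infty_natSinv_lt (PosNum d0).
  exists n => //; split => // s r sab rab /andP[s0 sn] /andP[r0 rn].
  have Hs : `|Q t s - l t| <= m.+1%:R^-1 / 2 by apply: H => //; rewrite s0 (lt_trans sn).
  have Hr : `|Q t r - l t| <= m.+1%:R^-1 / 2 by apply: H => //; rewrite r0 (lt_trans rn).
  rewrite -[Q t s](subrK (l t)) -addrA [leRHS]splitr.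
  by apply: (le_trans (ler_normD _ _)); rewrite lerD // distrC.
have mF m n : measurable (F m n) by exact: closed_measurable.
have mab : measurable (`[a, b]%classic : set R) by exact: measurable_itv.
have ab_fin : (mu `[a, b]%classic < +oo)%E.
  by rewrite lebesgue_measure_itv /=; case: ifP => // _; rewrite -EFinB ltry.
have small m : exists n, (mu (`[a, b]%classic `\` F m n) <= (eps / (2 ^ m.+1)%:R)%:E)%E.
  pose G n := `[a, b]%classic `\` F m n.
  have mG n : measurable (G n) by exact: measurableD.
  have Gcvg : mu (G n) @[n --> \oo] --> mu (\bigcap_n G n).
    apply: nonincreasing_cvg_mu => //.
    - by apply: le_lt_trans ab_fin; apply: le_outer_measure => ? [].
    - by apply: bigcapT_measurable => k; exact: mG.
    - move=> n k nk; apply/subsetPset; apply: setDS; apply/subsetPset; exact: Fnd.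
  have G0 : mu (\bigcap_n G n) = 0%E.
    apply/eqP; rewrite eq_le measure_ge0 andbT.
    have /negligible_outer_measure <- := N0.
    apply: le_outer_measure => t tG; apply: contrapT => Nt.
    have [tab _] := tG 0%N Logic.I.
    have [n _ Fn] := FN m t (conj tab Nt).
    by have [_] := tG n Logic.I.
  rewrite G0 in Gcvg.
  have : \forall n \near \oo, (mu (G n) < (eps / (2 ^ m.+1)%:R)%:E)%E.
    apply: (Gcvg [set x | (x < (eps / (2 ^ m.+1)%:R)%:E)%E]).
    apply: open_nbhs_nbhs; split; first exact: open_ereal_lt_ereal.
    by rewrite /= lte_fin divr_gt0 // ltr0n expn_gt0.
  by move=> [n _ /(_ n (leqnn n))/ltW]; exists n.
have [n Hn] := choice small.
exists (\bigcap_m F m (n m)); split.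
- by apply: closed_bigI => m _; exact: cF.
- by move=> t /(_ 0%N Logic.I)[tab _]; rewrite /= in_itv.
- rewrite setDE setC_bigcap setI_bigcupr.
  apply: (le_trans (outer_measure_sigma_subadditive _ _)).
  apply: (le_trans _ (epsilon_trick0 xpredT (ltW eps0))).
  by apply: lee_nneseries => // m _; rewrite -setDE; exact: Hn.
- move=> e e0; near \oo => m.
  have me : m.+1%:R^-1 < e / 2.
    by near: m; apply: (near_infty_natSinv_lt (PosNum (divr_gt0 e0 (ltr0Sn _ 1)))).
  exists (n m).+1%:R^-1; first by rewrite invr_gt0 ltr0n.
  move=> t s Kt Nt sab st; have [tab H] := Kt m Logic.I.
  have e20 : 0 < e / 2 by rewrite divr_gt0.
  have [d d0 Hd] := Ql t tab Nt _ e20.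
  (* Q t s is compared with Q t r for a point r between t and s, close enough
     to t for the pointwise limit at t to be effective *)
  have s0 : 0 < `|s - t| by case/andP: st.
  pose th := Num.min 1 (d / 2 / `|s - t|).
  have th0 : 0 < th by rewrite lt_min ltr01 !divr_gt0.
  have th1 : th <= 1 by rewrite ge_min lexx.
  pose r := t + th * (s - t).
  have rt : `|r - t| = th * `|s - t|.
    by rewrite /r addrAC subrr add0r normrM gtr0_norm.
  have rd : 0 < `|r - t| < d.
    rewrite rt mulr_gt0 //= (@le_lt_trans _ _ (d / 2)) //; last lra.
    by rewrite -ler_pdivlMr // ge_min lexx orbT.
  have rn : 0 < `|r - t| < (n m).+1%:R^-1.
    case/andP: rd => -> _ /=; case/andP: st => _; apply: le_lt_trans.
    by rewrite rt ler_piMl.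
  have rab : a <= r <= b.
    have -> : r = (1 - th) * t + th * s by rewrite /r; ring.
    case/andP: tab => at_ tb; case/andP: sab => as_ sb.
    have th1' : 0 <= 1 - th by rewrite subr_ge0.
    apply/andP; split.
      have -> : a = (1 - th) * a + th * a by ring.
      by rewrite lerD // ler_wpM2l // ltW.
    have -> : b = (1 - th) * b + th * b by ring.
    by rewrite lerD // ler_wpM2l // ltW.
  rewrite -[Q t s](subrK (Q t r)) -addrA [leRHS]splitr.
  apply: (le_trans (ler_normD _ _)); rewrite lerD //; last exact: Hd.
  by apply: le_trans (ltW me); exact: H.
Unshelve. all: by end_near. Qed.
End Uniform.

(** * Horizontal arcs across a gap *)

(** A point of the group with a prescribed horizontal velocity there. *)
Record jet (R : realType) := Jet {
  jx1 : R; jx2 : R; jx3 : R; jx4 : R; ju1 : R; ju2 : R }.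

(** C1 horizontal curves on the whole line, together with their controls; being
    defined everywhere, they need no one-sided derivatives at the ends of a
    gap. *)
Record arc (R : realType) := Arc {
  ax1 : R -> R; ax2 : R -> R; ax3 : R -> R; ax4 : R -> R;
  au1 : R -> R; au2 : R -> R;
  au1_continuous : continuous au1;
  au2_continuous : continuous au2;
  ax1_derive : forall t : R, is_derive t 1 ax1 (au1 t);
  ax2_derive : forall t : R, is_derive t 1 ax2 (au2 t);
  ax3_derive : forall t : R, is_derive t 1 ax3 (ax1 t * au2 t);
  ax4_derive : forall t : R, is_derive t 1 ax4 (ax1 t ^+ 2 / 2 * au2 t) }.

Definition jet_of (R : realType) (A : arc R) (t : R) : jet R :=
  Jet (ax1 A t) (ax2 A t) (ax3 A t) (ax4 A t) (au1 A t) (au2 A t).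

Section Arcs.
Context {R : realType}.
Implicit Types (P Q : jet R) (c d t : R).

Lemma is_derive_cts (f : R -> R) t l : is_derive t 1 f l -> {for t, continuous f}.
Proof. by case=> df _; exact/differentiable_continuous/derivable1_diffP. Qed.

Lemma line_arc P c : exists A : arc R, jet_of A c = P.
Proof.
case: P => p1 p2 p3 p4 v1 v2.
have cc (v : R) : continuous (cst v : R -> R) by exact: cst_continuous.
have D1 t : is_derive t 1 (fun s => p1 + v1 * (s - c)) v1 by derive_ring.
have D2 t : is_derive t 1 (fun s => p2 + v2 * (s - c)) v2 by derive_ring.
have D3 t : is_derive t 1 (fun s => p3 + v2 * (p1 * (s - c) + v1 / 2 * (s - c) ^+ 2))
    ((p1 + v1 * (t - c)) * v2) by derive_ring.
have D4 t : is_derive t 1 (fun s => p4 + v2 / 2 *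
      (p1 ^+ 2 * (s - c) + p1 * v1 * (s - c) ^+ 2 + v1 ^+ 2 / 3 * (s - c) ^+ 3))
    ((p1 + v1 * (t - c)) ^+ 2 / 2 * v2) by derive_ring.
exists (Arc (cc v1) (cc v2) D1 D2 D3 D4).
by rewrite /jet_of /=; congr Jet; ring.
Qed.

Lemma is_derive_join (f g : R -> R) (m t df dg : R) : f m = g m ->
  (t <= m -> is_derive t 1 f df) -> (m <= t -> is_derive t 1 g dg) -> (t = m -> df = dg) ->
  is_derive t 1 (fun s => if s <= m then f s else g s) (if t <= m then df else dg).
Proof.
move=> fg Hf Hg dfg; apply/is_deriveP => e e0; have [tm|mt|tm] := ltgtP t m.
- have [d d0 H] := (is_deriveP _ _ _).1 (Hf (ltW tm)) e e0.
  exists (Num.min d (m - t)); first by rewrite lt_min d0 subr_gt0.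
  move=> s; rewrite lt_min => /andP[/H {}H]; rewrite ltr_distl => /andP[_ sm].
  have -> : s <= m by lra.
  by [].
- have [d d0 H] := (is_deriveP _ _ _).1 (Hg (ltW mt)) e e0.
  exists (Num.min d (t - m)); first by rewrite lt_min d0 subr_gt0.
  move=> s; rewrite lt_min => /andP[/H {}H]; rewrite ltr_distl => /andP[sm _].
  by have /negbTE -> : ~~ (s <= m) by rewrite -ltNge; lra.
- have [|d1 d10 H1] := (is_deriveP _ _ _).1 (Hf _) e e0; first by rewrite tm.
  have [|d2 d20 H2] := (is_deriveP _ _ _).1 (Hg _) e e0; first by rewrite tm.
  exists (Num.min d1 d2); first by rewrite lt_min d10.
  move=> s; rewrite lt_min => /andP[/H1 {}H1 /H2 {}H2].
  case: ifP => // _; rewrite dfg // (_ : f t = g t) //; by rewrite tm.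
Qed.

Lemma continuous_join (f g : R -> R) (m : R) : f m = g m -> continuous f -> continuous g ->
  continuous (fun s => if s <= m then f s else g s).
Proof.
move=> fg fc gc t; apply/cvgrPdist_lt => e e0; have [tm|mt|tm] := ltgtP t m.
- near=> s; have -> : s <= m by apply: ltW; near: s; exact: lt_nbhsl.
  by near: s; exact: cvgr_dist_lt (fc t) _ e0.
- near=> s; have /negbTE -> : ~~ (s <= m) by rewrite -ltNge; near: s; exact: lt_nbhsr.
  by near: s; exact: cvgr_dist_lt (gc t) _ e0.
- near=> s; case: ifP => _.
    by near: s; exact: cvgr_dist_lt (fc t) _ e0.
  rewrite (_ : f t = g t); last by rewrite tm.
  by near: s; exact: cvgr_dist_lt (gc t) _ e0.
Unshelve. all: by end_near. Qed.

(** Equality of the jets at m makes the concatenation C1. *)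
Lemma join_arc (A B : arc R) (m : R) : jet_of A m = jet_of B m ->
  exists C : arc R, forall t, jet_of C t = if t <= m then jet_of A t else jet_of B t.
Proof.
move=> [e1 e2 e3 e4 f1 f2].
pose j (f g : R -> R) s := if s <= m then f s else g s.
have D (f g df dg : R -> R) t : f m = g m -> df m = dg m ->
    (forall t, is_derive t 1 f (df t)) -> (forall t, is_derive t 1 g (dg t)) ->
    is_derive t 1 (j f g) (j df dg t).
  by move=> fg dfg Hf Hg; apply: is_derive_join => // ->.
have C1 := continuous_join f1 (@au1_continuous _ A) (@au1_continuous _ B).
have C2 := continuous_join f2 (@au2_continuous _ A) (@au2_continuous _ B).
have D1 t := D _ _ _ _ t e1 f1 (@ax1_derive _ A) (@ax1_derive _ B).
have D2 t := D _ _ _ _ t e2 f2 (@ax2_derive _ A) (@ax2_derive _ B).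
have D3 t : is_derive t 1 (j (ax3 A) (ax3 B)) (j (ax1 A) (ax1 B) t * j (au2 A) (au2 B) t).
  have -> : j (ax1 A) (ax1 B) t * j (au2 A) (au2 B) t =
      j (fun t => ax1 A t * au2 A t) (fun t => ax1 B t * au2 B t) t.
    by rewrite /j; case: ifP.
  apply: D => //; [by rewrite e1 f2|exact: ax3_derive|exact: ax3_derive].
have D4 t : is_derive t 1 (j (ax4 A) (ax4 B)) (j (ax1 A) (ax1 B) t ^+ 2 / 2 * j (au2 A) (au2 B) t).
  have -> : j (ax1 A) (ax1 B) t ^+ 2 / 2 * j (au2 A) (au2 B) t =
      j (fun t => ax1 A t ^+ 2 / 2 * au2 A t) (fun t => ax1 B t ^+ 2 / 2 * au2 B t) t.
    by rewrite /j; case: ifP.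
  apply: D => //; [by rewrite e1 f2|exact: ax4_derive|exact: ax4_derive].
exists (Arc C1 C2 D1 D2 D3 D4) => t.
by rewrite /jet_of /= /j; case: ifP.
Qed.

(** The coordinates of P^-1 * Q in the group: the displacements from P to Q as
    seen from the identity. *)
Definition disp1 P Q := jx1 Q - jx1 P.
Definition disp2 P Q := jx2 Q - jx2 P.
Definition disp3 P Q := jx3 Q - jx3 P - jx1 P * (jx2 Q - jx2 P).
Definition disp4 P Q :=
  jx4 Q - jx4 P - jx1 P * (jx3 Q - jx3 P) + jx1 P ^+ 2 / 2 * (jx2 Q - jx2 P).

(** Quadratic in tau, with values v1, w1 at 0, 1 and mean value Y / l; it is the
    control u1 on a gap of length l across which x1 increases by Y.  The
    coefficient of tau (1 - tau) vanishes when Y / l is the mean of v1, w1. *)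
Definition hermite_u1 (v1 w1 Y l tau : R) : R :=
  v1 + (w1 - v1) * tau + 6 * (Y / l - (v1 + w1) / 2) * tau * (1 - tau).

Definition hermite_x1 (v1 w1 Y l tau : R) : R :=
  v1 * tau + (w1 - v1) / 2 * tau ^+ 2 +
  (Y / l - (v1 + w1) / 2) * (3 * tau ^+ 2 - 2 * tau ^+ 3).

(** The solution of the linear system for the quartic q without constant term
    such that int q = e0, int s q = e1, int s^2 q = e2 over [0, 1], q(1) = e3. *)
Definition quartic_coef (e0 e1 e2 e3 : R) : R * R * R * R :=
  (120 * e0 - 480 * e1 + 420 * e2 - 4 * e3,
   - 600 * e0 + 2700 * e1 - 2520 * e2 + 30 * e3,
   900 * e0 - 4320 * e1 + 4200 * e2 - 60 * e3,
   - 420 * e0 + 2100 * e1 - 2100 * e2 + 35 * e3).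

Definition quartic (a : R * R * R * R) (s : R) : R :=
  a.1.1.1 * s + a.1.1.2 * s ^+ 2 + a.1.2 * s ^+ 3 + a.2 * s ^+ 4.

(** In the parameter sigma = (x1 - x1(P)) / Y, the slope dx2/dx1 is p + q(sigma)
    with p the slope at P; these are the moments and the end value imposed on
    q, that is, the defects of the data from those of the constant slope p. *)
Definition gap_errors P Q : R * R * R * R :=
  let Y := disp1 P Q in
  let p := ju2 P / ju1 P in
  (disp2 P Q / Y - p, disp3 P Q / Y ^+ 2 - p / 2,
   2 * disp4 P Q / Y ^+ 3 - p / 3, ju2 Q / ju1 Q - p).

Definition gap_u1 c d P Q s : R :=
  hermite_u1 (ju1 P) (ju1 Q) (disp1 P Q) (d - c) ((s - c) / (d - c)).

(** The normalized increment of x1, from 0 to 1 across the gap. *)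
Definition gap_sigma c d P Q s : R :=
  (d - c) * hermite_x1 (ju1 P) (ju1 Q) (disp1 P Q) (d - c) ((s - c) / (d - c))
    / disp1 P Q.

Definition gap_u2 c d P Q s : R :=
  let e := gap_errors P Q in
  (ju2 P / ju1 P + quartic (quartic_coef e.1.1.1 e.1.1.2 e.1.2 e.2) (gap_sigma c d P Q s))
    * gap_u1 c d P Q s.

(** x2, x3, x4 are obtained by integrating p + q, sigma (p + q) and
    sigma^2 (p + q) as polynomials in sigma.  The path sigma need not be
    monotone. *)
Lemma gap_arc c d P Q : c < d -> jx1 P != jx1 Q -> ju1 P != 0 -> ju1 Q != 0 ->
  exists A : arc R, [/\ jet_of A c = P, jet_of A d = Q &
    forall s, au1 A s = gap_u1 c d P Q s /\ au2 A s = gap_u2 c d P Q s].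
Proof.
move=> cd; rewrite eq_sym -subr_eq0 -/(disp1 P Q) => Y0 v0 w0.
set Y := disp1 P Q in Y0.
have l0 : d - c != 0 by rewrite subr_eq0 gt_eqF.
set l := d - c in l0.
pose sg := gap_sigma c d P Q.
have Dtau t : is_derive t 1 (fun s => (s - c) / l) l^-1.
  by derive_ring.
have Dsg t : is_derive t 1 sg (gap_u1 c d P Q t / Y).
  have Dt := Dtau t.
  rewrite /sg /gap_sigma /gap_u1 /hermite_x1 /hermite_u1 -/l -/Y.
  by derive_ring; rewrite Y0 l0.
pose e := gap_errors P Q.
pose a := quartic_coef e.1.1.1 e.1.1.2 e.1.2 e.2.
pose p := ju2 P / ju1 P.
pose R0 s := p * s + a.1.1.1 / 2 * s ^+ 2 + a.1.1.2 / 3 * s ^+ 3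
  + a.1.2 / 4 * s ^+ 4 + a.2 / 5 * s ^+ 5.
pose R1 s := p / 2 * s ^+ 2 + a.1.1.1 / 3 * s ^+ 3 + a.1.1.2 / 4 * s ^+ 4
  + a.1.2 / 5 * s ^+ 5 + a.2 / 6 * s ^+ 6.
pose R2 s := p / 3 * s ^+ 3 + a.1.1.1 / 4 * s ^+ 4 + a.1.1.2 / 5 * s ^+ 5
  + a.1.2 / 6 * s ^+ 6 + a.2 / 7 * s ^+ 7.
pose G1 s := jx1 P + Y * sg s.
pose G2 s := jx2 P + Y * R0 (sg s).
pose G3 s := jx3 P + jx1 P * Y * R0 (sg s) + Y ^+ 2 * R1 (sg s).
pose G4 s := jx4 P + jx1 P ^+ 2 / 2 * Y * R0 (sg s)
  + jx1 P * Y ^+ 2 * R1 (sg s) + Y ^+ 3 / 2 * R2 (sg s).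
have D1 t : is_derive t 1 G1 (gap_u1 c d P Q t).
  by have Ds := Dsg t; rewrite /G1; derive_ring.
have D2 t : is_derive t 1 G2 (gap_u2 c d P Q t).
  have Ds := Dsg t; rewrite /G2 /R0 /gap_u2 -/e -/a -/p -/sg /quartic.
  by move: (gap_u1 _ _ _ _ _) Ds => U Ds; clearbody sg a p Y; derive_ring.
have D3 t : is_derive t 1 G3 (G1 t * gap_u2 c d P Q t).
  have Ds := Dsg t; rewrite /G1 /G3 /R0 /R1 /gap_u2 -/e -/a -/p -/sg /quartic.
  by move: (gap_u1 _ _ _ _ _) Ds => U Ds; clearbody sg a p Y; derive_ring.
have D4 t : is_derive t 1 G4 (G1 t ^+ 2 / 2 * gap_u2 c d P Q t).
  have Ds := Dsg t; rewrite /G1 /G4 /R0 /R1 /R2 /gap_u2 -/e -/a -/p -/sg /quartic.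
  by move: (gap_u1 _ _ _ _ _) Ds => U Ds; clearbody sg a p Y; derive_ring.
have DU1 t : exists df, is_derive t 1 (gap_u1 c d P Q) df.
  have Dt := Dtau t; rewrite /gap_u1 /hermite_u1 -/l -/Y; eexists; derive_rules.
have C1 : continuous (gap_u1 c d P Q) by move=> t; have [df /is_derive_cts] := DU1 t.
have C2 : continuous (gap_u2 c d P Q).
  move=> t; have [df Du] := DU1 t; have Ds := Dsg t.
  have [dg] : exists dg, is_derive t 1 (gap_u2 c d P Q) dg.
    rewrite /gap_u2 -/e -/a -/p -/sg /quartic; eexists; derive_rules.
  exact: is_derive_cts.
have sgc : sg c = 0 by rewrite /sg /gap_sigma /hermite_x1 subrr mul0r; ring.
have sgd : sg d = 1.
  rewrite /sg /gap_sigma /hermite_x1 -/l -/Y divff //; field; by rewrite Y0 l0.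
have u1c : gap_u1 c d P Q c = ju1 P by rewrite /gap_u1 /hermite_u1 subrr mul0r; ring.
have u1d : gap_u1 c d P Q d = ju1 Q by rewrite /gap_u1 /hermite_u1 -/l divff //; ring.
exists (Arc C1 C2 D1 D2 D3 D4); split => //.
- rewrite /jet_of /= /G1 /G2 /G3 /G4 /R0 /R1 /R2 sgc u1c.
  rewrite /gap_u2 -/sg sgc u1c /quartic.
  transitivity (Jet (jx1 P) (jx2 P) (jx3 P) (jx4 P) (ju1 P) (ju2 P)); last by case: (P).
  congr Jet; try ring; rewrite /p; by field.
- rewrite /jet_of /= /G1 /G2 /G3 /G4 /R0 /R1 /R2 sgd u1d.
  rewrite /gap_u2 -/sg sgd u1d /quartic /p /a /e /gap_errors /disp2 /disp3 /disp4 -/Y /=.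
  transitivity (Jet (jx1 Q) (jx2 Q) (jx3 Q) (jx4 Q) (ju1 Q) (ju2 Q)); last by case: (Q).
  have EQ1 : jx1 Q = jx1 P + Y by rewrite /Y /disp1 addrC subrK.
  by congr Jet; rewrite ?mulr1 -?EQ1 //; field; rewrite ?Y0 ?v0 ?w0.
Qed.

(** When x1 takes the same value at both ends, the arc passes through an
    intermediate point with another value of x1. *)
Lemma connecting_arc c d P Q : c < d -> ju1 P != 0 -> ju1 Q != 0 ->
  exists A : arc R, [/\ jet_of A c = P, jet_of A d = Q & jx1 P != jx1 Q ->
    forall s, au1 A s = gap_u1 c d P Q s /\ au2 A s = gap_u2 c d P Q s].
Proof.
move=> cd v0 w0; have [E|NE] := eqVneq (jx1 P) (jx1 Q); last first.
  by have [A [Ac Ad AE]] := gap_arc cd NE v0 w0; exists A.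
pose M := Jet (jx1 P + 1) 0 0 0 1 0.
have PM : jx1 P != jx1 M by rewrite /= eq_sym -subr_eq0 addrAC subrr add0r oner_eq0.
have MQ : jx1 M != jx1 Q by rewrite -E eq_sym.
have M0 : ju1 M != 0 by exact: oner_neq0.
have cm : c < (c + d) / 2 by lra.
have md : (c + d) / 2 < d by lra.
have [A [Ac Am _]] := gap_arc cm PM v0 M0.
have [B [Bm Bd _]] := gap_arc md MQ M0 w0.
have [|C HC] := @join_arc A B ((c + d) / 2); first by rewrite Am Bm.
exists C; split; rewrite ?HC ?(ltW cm) //.
by rewrite leNgt md.
Qed.

End Arcs.

(** * Controls on short gaps *)

Section GapLimit.
Context {R : realType} {T : Type} {F : set_system T} {FF : Filter F}.

Lemma cvg_funD (f g : T -> R) (a b : R) : f @ F --> a -> g @ F --> b ->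
  (fun x => f x + g x) @ F --> a + b.
Proof. exact: cvgD. Qed.

Lemma cvg_funB (f g : T -> R) (a b : R) : f @ F --> a -> g @ F --> b ->
  (fun x => f x - g x) @ F --> a - b.
Proof. exact: cvgB. Qed.

Lemma cvg_funM (f g : T -> R) (a b : R) : f @ F --> a -> g @ F --> b ->
  (fun x => f x * g x) @ F --> a * b.
Proof. exact: cvgM. Qed.

Lemma cvg_funV (f : T -> R) (a : R) : a != 0 -> f @ F --> a -> (fun x => (f x)^-1) @ F --> a^-1.
Proof. exact: cvgV. Qed.

Lemma cvg_ext (f g : T -> R) (a : R) : f =1 g -> g @ F --> a -> f @ F --> a.
Proof. by move=> /funext ->. Qed.

Lemma cvg0_mul_bounded (f g : T -> R) (C : R) : f @ F --> (0 : R) ->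
  (\forall x \near F, `|g x| <= C) -> (fun x => f x * g x) @ F --> (0 : R).
Proof.
move=> f0 gC; apply/cvgr0Pnorm_le => e e0.
have C1 : 0 < `|C| + 1 by rewrite ltr_wpDl.
near=> x; rewrite normrM.
have fx : `|f x| <= e / (`|C| + 1).
  near: x; move/cvgr0Pnorm_le : f0; apply; exact: divr_gt0.
have gx : `|g x| <= `|C| + 1.
  have : `|g x| <= C by near: x.
  by move=> /le_trans; apply; rewrite (le_trans (ler_norm C)) // lerDl.
have -> : e = e / (`|C| + 1) * (`|C| + 1) by rewrite divfK // gt_eqF.
exact: ler_pM.
Unshelve. all: by end_near. Qed.

(* A family of gaps [c, d], with jets P and Q at the ends and a point s inside,
   along which the displacements have the scaling of a constant control (v, w). *)
Variables (c d s : T -> R) (P Q : T -> jet R) (v w : R).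
Let l x := d x - c x.
Let Y x := disp1 (P x) (Q x).
Let D2 x := disp2 (P x) (Q x).
Let D3 x := disp3 (P x) (Q x).
Let D4 x := disp4 (P x) (Q x).
Hypothesis v_neq0 : v != 0.
Hypothesis csd : \forall x \near F, [/\ c x < d x, c x <= s x & s x <= d x].
Hypothesis u1P : (fun x => ju1 (P x)) @ F --> v.
Hypothesis u1Q : (fun x => ju1 (Q x)) @ F --> v.
Hypothesis u2P : (fun x => ju2 (P x)) @ F --> w.
Hypothesis u2Q : (fun x => ju2 (Q x)) @ F --> w.
Hypothesis Yl : (fun x => Y x / l x) @ F --> v.
Hypothesis D2l : (fun x => D2 x / l x) @ F --> w.
Hypothesis D3l : (fun x => D3 x / l x ^+ 2) @ F --> v * w / 2.
Hypothesis D4l : (fun x => D4 x / l x ^+ 3) @ F --> v ^+ 2 * w / 6.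

Let tau x := (s x - c x) / (d x - c x).

Let tau01 : \forall x \near F, 0 <= tau x <= 1.
Proof.
near=> x; have [cd cs sd] : [/\ c x < d x, c x <= s x & s x <= d x] by near: x.
have l0 : 0 < d x - c x by rewrite subr_gt0.
by rewrite /tau divr_ge0 ?subr_ge0 ?(ltW cd) // ler_pdivrMr // mul1r lerD2r.
Unshelve. all: by end_near. Qed.

Let kappa0 : (fun x => Y x / l x - (ju1 (P x) + ju1 (Q x)) / 2) @ F --> (0 : R).
Proof.
have -> : (0 : R) = v - (v + v) / 2 by field.
by apply: cvg_funB => //; apply: cvg_funM; [exact: cvg_funD|exact: cvg_cst].
Qed.

Lemma cvg_gap_u1 : (fun x => gap_u1 (c x) (d x) (P x) (Q x) (s x)) @ F --> v.
Proof.
have -> : v = v + 0 + 0 by rewrite !addr0.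
rewrite /gap_u1 /hermite_u1; apply: cvg_funD; first apply: cvg_funD => //.
- apply: (@cvg0_mul_bounded _ _ 1).
    have -> : (0 : R) = v - v by rewrite subrr.
    by apply: cvg_funB.
  by apply: filterS tau01 => x /andP[t0 t1]; rewrite ger0_norm.
- under eq_fun do rewrite -mulrA.
  apply: (@cvg0_mul_bounded _ _ 1).
    have -> : (0 : R) = 6 * 0 by rewrite mulr0.
    by apply: cvg_funM; [exact: cvg_cst|exact: kappa0].
  apply: filterS tau01 => x /andP[t0 t1]; rewrite -/(tau x).
  rewrite ger0_norm; last by rewrite mulr_ge0 // subr_ge0.
  by rewrite mulr_ile1 ?subr_ge0 // gerBl.
Qed.

Lemma near_gap_neq : \forall x \near F, jx1 (P x) != jx1 (Q x).
Proof.
have : \forall x \near F, Y x / l x != 0.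
  by move/cvgrPdist_lt : Yl => /(_ `|v|); rewrite normr_gt0 => /(_ v_neq0);
    apply: filterS => x; apply: contraTN => /eqP ->; rewrite subr0 ltxx.
by apply: filterS => x; rewrite mulf_eq0 negb_or subr_eq0 eq_sym => /andP[].
Qed.

(** sigma is bounded without being close to a constant, so that only the
    smallness of the coefficients of q can be used. *)
Let sigma_bounded : exists C, \forall x \near F,
  `|gap_sigma (c x) (d x) (P x) (Q x) (s x)| <= C.
Proof.
pose H x := hermite_x1 (ju1 (P x)) (ju1 (Q x)) (disp1 (P x) (Q x)) (d x - c x) (tau x).
have Hlim : (fun x => H x - v * tau x) @ F --> (0 : R).
  have -> : (fun x => H x - v * tau x) = (fun x => (ju1 (P x) - v) * tau x +
      (ju1 (Q x) - ju1 (P x)) / 2 * tau x ^+ 2 +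
      (Y x / l x - (ju1 (P x) + ju1 (Q x)) / 2) * (3 * tau x ^+ 2 - 2 * tau x ^+ 3)).
    by apply/funext => x; rewrite /H /hermite_x1 /Y /l; ring.
  have -> : (0 : R) = 0 + 0 + 0 by rewrite !addr0.
  apply: cvg_funD; first apply: cvg_funD.
  - apply: (@cvg0_mul_bounded _ _ 1).
      have -> : (0 : R) = v - v by rewrite subrr.
    by apply: cvg_funB => //; exact: cvg_cst.
    by apply: filterS tau01 => x /andP[t0 t1]; rewrite ger0_norm.
  - apply: (@cvg0_mul_bounded _ _ 1).
      have -> : (0 : R) = (v - v) / 2 by rewrite subrr mul0r.
      by apply: cvg_funM; [exact: cvg_funB|exact: cvg_cst].
    by apply: filterS tau01 => x /andP[t0 t1]; rewrite ger0_norm ?exprn_ge0 // exprn_ile1.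
  - apply: (@cvg0_mul_bounded _ _ 5); first exact: kappa0.
    apply: filterS tau01 => x /andP[t0 t1].
    have t2 : 0 <= tau x ^+ 2 by exact: exprn_ge0.
    have t3 : 0 <= tau x ^+ 3 by exact: exprn_ge0.
    have t2' : tau x ^+ 2 <= 1 by rewrite exprn_ile1.
    have t3' : tau x ^+ 3 <= 1 by rewrite exprn_ile1.
    by rewrite ler_norml; apply/andP; split; lra.
exists ((`|v| + 1) / (`|v| / 2)).
have v0 : 0 < `|v| by rewrite normr_gt0.
near=> x; have [cd cs sd] : [/\ c x < d x, c x <= s x & s x <= d x] by near: x.
have Hx : `|H x| <= `|v| + 1.
  rewrite -[H x](subrK (v * tau x)) addrC; apply: (le_trans (ler_normD _ _)).
  rewrite lerD //; last by near: x; move/cvgr0Pnorm_le : Hlim; apply.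
  have /andP[t0 t1] : 0 <= tau x <= 1 by near: x.
  by rewrite normrM ler_piMr // ger0_norm.
have Yx : `|v| / 2 <= `|Y x / l x|.
  have : `|v - Y x / l x| < `|v| / 2.
    by near: x; move/cvgrPdist_lt : Yl; apply; rewrite divr_gt0.
  have := ler_normD (v - Y x / l x) (Y x / l x); rewrite subrK; lra.
have -> : gap_sigma (c x) (d x) (P x) (Q x) (s x) = H x / (Y x / l x).
  by rewrite /gap_sigma -/(H x) -/(l x) -/(Y x) invf_div mulrA [l x * H x]mulrC.
rewrite normrM normfV; apply: ler_pM => //.
by rewrite lef_pV2 ?posrE // ?divr_gt0 // (lt_le_trans _ Yx) // divr_gt0.
Unshelve. all: by end_near. Qed.

Lemma cvg_gap_u2 : (fun x => gap_u2 (c x) (d x) (P x) (Q x) (s x)) @ F --> w.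
Proof.
pose e x := gap_errors (P x) (Q x).
have pl : (fun x => ju2 (P x) / ju1 (P x)) @ F --> w / v.
  by apply: cvg_funM => //; apply: cvg_funV.
have lneq : \forall x \near F, l x != 0.
  by apply: filterS csd => x [cd _ _]; rewrite /l subr_eq0 gt_eqF.
have e0 : (fun x => (e x).1.1.1) @ F --> (0 : R).
  have -> : (0 : R) = w / v - w / v by rewrite subrr.
  apply: cvg_funB => //.
  have E : \forall x \near F, (D2 x / l x) / (Y x / l x) = D2 x / Y x.
    by apply: filterS lneq => x l0; rewrite invf_div mulrA divfK.
  apply: cvg_trans (near_eq_cvg E) _; apply: cvg_funM => //; exact: cvg_funV.
have e1 : (fun x => (e x).1.1.2) @ F --> (0 : R).
  have -> : (0 : R) = (v * w / 2) / v ^+ 2 - (w / v) / 2 by field.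
  apply: cvg_funB; last by apply: cvg_funM => //; exact: cvg_cst.
  have E : \forall x \near F, (D3 x / l x ^+ 2) / (Y x / l x) ^+ 2 = D3 x / Y x ^+ 2.
    by apply: filterS lneq => x l0; rewrite expr_div_n invf_div mulrA divfK // expf_neq0.
  apply: cvg_trans (near_eq_cvg E) _; apply: cvg_funM => //; apply: cvg_funV; first by rewrite expf_neq0.
  by under eq_fun do rewrite expr2; rewrite expr2; apply: cvg_funM.
have e2 : (fun x => (e x).1.2) @ F --> (0 : R).
  have -> : (0 : R) = 2 * (v ^+ 2 * w / 6) / v ^+ 3 - (w / v) / 3 by field.
  apply: cvg_funB; last by apply: cvg_funM => //; exact: cvg_cst.
  have E : \forall x \near F, 2 * (D4 x / l x ^+ 3) / (Y x / l x) ^+ 3 = 2 * D4 x / Y x ^+ 3.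
    by apply: filterS lneq => x l0; rewrite expr_div_n invf_div [2 * _]mulrA mulrA divfK // expf_neq0.
  apply: cvg_trans (near_eq_cvg E) _; apply: cvg_funM.
    by apply: cvg_funM => //; exact: cvg_cst.
  apply: cvg_funV; first by rewrite expf_neq0.
  under eq_fun do rewrite exprS expr2; rewrite exprS expr2.
  by apply: cvg_funM => //; exact: cvg_funM.
have e3 : (fun x => (e x).2) @ F --> (0 : R).
  have -> : (0 : R) = w / v - w / v by rewrite subrr.
  by apply: cvg_funB => //; apply: cvg_funM => //; exact: cvg_funV.
have comb (k0 k1 k2 k3 : R) : (fun x => k0 * (e x).1.1.1 + k1 * (e x).1.1.2
    + k2 * (e x).1.2 + k3 * (e x).2) @ F --> (0 : R).
  have -> : (0 : R) = k0 * 0 + k1 * 0 + k2 * 0 + k3 * 0 by ring.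
  by do 3 (apply: cvg_funD; last by apply: cvg_funM => //; exact: cvg_cst);
    apply: cvg_funM => //; exact: cvg_cst.
have [C sC] := sigma_bounded.
pose sg x := gap_sigma (c x) (d x) (P x) (Q x) (s x).
have term n (f : T -> R) : f @ F --> (0 : R) -> (fun x => f x * sg x ^+ n) @ F --> (0 : R).
  move=> f0; apply: (@cvg0_mul_bounded _ _ (C ^+ n)) => //.
  by apply: filterS sC => x sx; rewrite normrX lerXn2r // ?nnegrE // (le_trans _ sx).
have q0 : (fun x => quartic (quartic_coef (e x).1.1.1 (e x).1.1.2 (e x).1.2 (e x).2) (sg x)) @ F --> (0 : R).
  have -> : (0 : R) = 0 + 0 + 0 + 0 by rewrite !addr0.
  rewrite /quartic /=; apply: cvg_funD; first apply: cvg_funD; first apply: cvg_funD.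
  - by apply: (cvg_ext _ (term 1%N _ (comb 120 (- 480) 420 (- 4)))) => x /=; ring.
  - by apply: (cvg_ext _ (term 2%N _ (comb (- 600) 2700 (- 2520) 30))) => x /=; ring.
  - by apply: (cvg_ext _ (term 3%N _ (comb 900 (- 4320) 4200 (- 60)))) => x /=; ring.
  - by apply: (cvg_ext _ (term 4%N _ (comb (- 420) 2100 (- 2100) 35))) => x /=; ring.
have -> : w = (w / v + 0) * v by rewrite addr0 divfK.
by apply: cvg_funM; [exact: cvg_funD|exact: cvg_gap_u1].
Qed.

End GapLimit.

(** * Gluing over the gaps of a closed set *)

Section Brackets.
Context {R : realType}.

(** lo s and hi s are the ends of the gap of K that contains s.  Left of K, where
    there is no left end, lo s is the first point of K as well, and
    symmetrically on the right; on these two unbounded components the data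
    attached to (lo s, hi s) are those of a degenerate gap, as at a point s of
    K, where both ends are s. *)
Record brackets (K : set R) (lo hi : R -> R) : Prop := Brackets {
  br_lo : forall s, K (lo s);
  br_hi : forall s, K (hi s);
  br_lohi : forall s, lo s <= hi s;
  br_id : forall s, K s -> lo s = s /\ hi s = s;
  br_left : forall k s, K k -> k <= s -> k <= lo s /\ lo s <= s;
  br_right : forall k s, K k -> s <= k -> s <= hi s /\ hi s <= k;
  br_local : forall s s', s <= s' -> (forall k, s <= k <= s' -> ~ K k) ->
    lo s = lo s' /\ hi s = hi s' }.

Lemma brackets_exist (K : set R) : closed K -> K !=set0 ->
  exists lo hi, brackets K lo hi.
Proof.
move=> cK [k0 Kk0].
pose Lf s := K `&` [set k | k <= s]; pose Rt s := K `&` [set k | s <= k].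
have supL s : Lf s !=set0 -> [/\ Lf s (sup (Lf s)) & forall k, Lf s k -> k <= sup (Lf s)].
  move=> L0; have uL : has_ubound (Lf s) by exists s => k [].
  have cL : closed (Lf s) by apply: closedI => //; exact: closed_le.
  split; last by move=> k; exact: ub_le_sup.
  by have := closure_sup L0 uL; rewrite -(proj1 (closure_id _) cL).
have infR s : Rt s !=set0 -> [/\ Rt s (inf (Rt s)) & forall k, Rt s k -> inf (Rt s) <= k].
  move=> L0; have uL : has_lbound (Rt s) by exists s => k [].
  have cL : closed (Rt s) by apply: closedI => //; exact: closed_ge.
  split; last by move=> k; exact: ge_inf.
  apply: cL => B /nbhs_ballP[r /= r0 rB].
  have [k Lk kr] := inf_adherent r0 (conj L0 uL).
  exists k; split => //; apply: rB; rewrite /ball /= distrC ger0_norm ?subr_ge0 ?ge_inf //.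
  by rewrite ltrBlDl.
pose lo s := if `[< Lf s !=set0 >] then sup (Lf s) else inf (Rt s).
pose hi s := if `[< Rt s !=set0 >] then inf (Rt s) else sup (Lf s).
have LR s : Lf s !=set0 \/ Rt s !=set0.
  by have [ks|/ltW sk] := leP k0 s; [left|right]; exists k0.
have locase s : (Lf s !=set0 /\ lo s = sup (Lf s)) \/
    (~ (Lf s !=set0) /\ Rt s !=set0 /\ lo s = inf (Rt s)).
  rewrite /lo; case: asboolP => L0; [by left|right; split => //; split => //].
  by case: (LR s).
have hicase s : (Rt s !=set0 /\ hi s = inf (Rt s)) \/
    (~ (Rt s !=set0) /\ Lf s !=set0 /\ hi s = sup (Lf s)).
  rewrite /hi; case: asboolP => L0; [by left|right; split => //; split => //].
  by case: (LR s).
have left_ k s : K k -> k <= s -> k <= lo s /\ lo s <= s.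
  move=> Kk ks; have Lk : Lf s k by [].
  have L0 : Lf s !=set0 by exists k.
  case: (locase s) => [[_ ->]|[]//]; have [[_ ?] H] := supL s L0.
  by split=> //; exact: H.
have right_ k s : K k -> s <= k -> s <= hi s /\ hi s <= k.
  move=> Kk ks; have Lk : Rt s k by [].
  have L0 : Rt s !=set0 by exists k.
  case: (hicase s) => [[_ ->]|[]//]; have [[_ ?] H] := infR s L0.
  by split=> //; exact: H.
exists lo, hi; split => //.
- move=> s; case: (locase s) => [[L0 ->]|[_ [R0 ->]]].
    by have [[]] := supL s L0.
  by have [[]] := infR s R0.
- move=> s; case: (hicase s) => [[R0 ->]|[_ [L0 ->]]].
    by have [[]] := infR s R0.
  by have [[]] := supL s L0.
- move=> s; case: (locase s) => [[L0 ->]|[nL [R0 ->]]].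
    have [[_ Ls] _] := supL s L0.
    case: (hicase s) => [[R0 ->]|[_ [_ ->//]]].
    by have [[_ Rs] _] := infR s R0; exact: le_trans Rs.
  by case: (hicase s) => [[_ ->//]|[]].
- move=> s Ks; have [h1 h2] := left_ s s Ks (lexx s).
  have [h3 h4] := right_ s s Ks (lexx s).
  by split; apply/eqP; rewrite eq_le ?h1 ?h2 ?h3 ?h4.
- move=> s s' ss' nK.
  have EL : Lf s = Lf s'.
    apply/seteqP; split => k [Kk ks]; split => //=; first exact: le_trans ss'.
    by have [//|/ltW sk] := leP k s; case: (nK k) => //; rewrite sk.
  have ER : Rt s = Rt s'.
    apply/seteqP; split => k [Kk ks]; split => //=; last exact: le_trans ks.
    by have [//|/ltW sk] := leP s' k; case: (nK k) => //; rewrite sk andbT.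
  by rewrite /lo /hi EL ER.
Qed.

(** The reflection t -> - t, which deduces glue_left from glue_right. *)
Lemma brackets_opp (K : set R) lo hi : brackets K lo hi ->
  brackets [set k | K (- k)] (fun s => - hi (- s)) (fun s => - lo (- s)).
Proof.
case=> H1 H2 H3 H4 H5 H6 H7; split => //=.
- by move=> s; rewrite opprK.
- by move=> s; rewrite opprK.
- by move=> s; rewrite lerN2.
- by move=> s /H4[-> ->]; rewrite opprK.
- move=> k s Kk ks; have [||h1 h2] := H6 (- k) (- s); rewrite ?lerN2 //.
  by rewrite lerNr h2 lerNl.
- move=> k s Kk ks; have [||h1 h2] := H5 (- k) (- s); rewrite ?lerN2 //.
  by rewrite lerNr h2 lerNl.
- move=> s s' ss' nK; have [||-> ->//] := H7 (- s') (- s); first by rewrite lerN2.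
  move=> k /andP[h1 h2] Kk; apply: (nK (- k)); last by rewrite /= opprK.
  by rewrite lerNr h2 lerNl.
Qed.

(** The conditions under which replacing u by U c d on each gap [c, d] of K
    gives a continuous function. *)
Definition glues_along (K : set R) (U : R -> R -> R -> R) (u : R -> R) :=
  [/\ forall c d, continuous (U c d),
      forall c d, K c -> K d -> c <= d -> U c d c = u c /\ U c d d = u d,
      forall t, K t -> forall e, 0 < e -> exists2 r, 0 < r & forall s, K s ->
        `|s - t| < r -> `|u s - u t| <= e &
      forall t, K t -> forall e, 0 < e -> exists2 r, 0 < r & forall c d s,
        K c -> K d -> c < d -> c <= s -> s <= d -> `|c - t| < r -> `|d - t| < r ->
        `|U c d s - u t| <= e].

(** If K does not accumulate at t from the right, then U (lo s) (hi s) is a fixed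
    function right of t.  Otherwise the gaps right of t are short. *)
Lemma glue_right (K : set R) lo hi U u : brackets K lo hi -> glues_along K U u ->
  forall t, K t -> forall e, 0 < e -> exists2 r, 0 < r & forall s, t <= s -> s < t + r ->
    `|U (lo s) (hi s) s - u t| <= e.
Proof.
move=> br [Uc Uend uc Usmall] t Kt e e0.
have FK s : K s -> U (lo s) (hi s) s = u s.
  by move=> Ks; have [-> ->] := br_id br Ks; have [] := Uend s s Ks Ks (lexx s).
have [[s0 [ts0 nK]]|acc] := pselect (exists s0, t < s0 /\ forall k, t < k <= s0 -> ~ K k).
  have los s : t < s -> s <= s0 -> lo s = t.
    move=> ts ss0; have [h1 h2] := br_left br Kt (ltW ts).
    apply/eqP; rewrite eq_le h1 andbT leNgt; apply/negP => tl.
    by apply: (nK (lo s)); [rewrite tl (le_trans h2)|exact: br_lo br s].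
  have his s : t < s -> s <= s0 -> hi s = hi s0.
    move=> ts ss0; have noK k : s <= k <= s0 -> ~ K k.
      by move=> /andP[sk ks0]; apply: nK; rewrite ks0 (lt_le_trans ts).
    by have [_ ->] := br_local br ss0 noK.
  have Kh := br_hi br s0; have th : t <= hi s0 by have := br_lohi br s0; rewrite (los _ ts0).
  have [Ut _] := Uend t (hi s0) Kt Kh th.
  have /cvgrPdist_le /(_ e e0) /nbhs_ballP[r /= r0 Hr] := Uc t (hi s0) t.
  exists (Num.min r (s0 - t)); first by rewrite lt_min r0 subr_gt0.
  move=> s; rewrite le_eqVlt => /predU1P[<- _|ts].
    by rewrite FK // subrr normr0 ltW.
  rewrite -ltrBlDl lt_min => /andP[sr ss0].
  have ss0' : s <= s0 by rewrite ltW //; move: ss0; rewrite ltrBlDr subrK.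
  rewrite los // his // distrC -Ut; apply: Hr.
  by rewrite /ball /= distrC ger0_norm // subr_ge0 ltW.
have [r1 r10 H1] := uc t Kt e e0; have [r2 r20 H2] := Usmall t Kt e e0.
pose r := Num.min r1 r2; have r0 : 0 < r by rewrite lt_min r10.
have [k [tk kr Kk]] : exists k, [/\ t < k, k <= t + r / 2 & K k].
  apply: contrapT => nk; apply: acc; exists (t + r / 2).
  split; first by rewrite ltrDl divr_gt0.
  by move=> k /andP[tk kr] Kk; apply: nk; exists k.
exists (k - t); first by rewrite subr_gt0.
move=> s ts; rewrite subrKC => sk.
have r2r : r / 2 < r by rewrite ltr_pdivrMr // ltr_pMr // ltr1n.
have close x : t <= x -> x <= k -> `|x - t| < r1 /\ `|x - t| < r2.
  move=> tx xk; have : `|x - t| < r.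
    rewrite ger0_norm ?subr_ge0 //; apply: le_lt_trans r2r.
    by rewrite lerBlDl (le_trans xk).
  by rewrite lt_min => /andP[].
have [Ks|nKs] := pselect (K s).
  by rewrite FK //; apply: H1 => //; have [] := close s ts (ltW sk).
have [l1 l2] := br_left br Kt ts; have [h1 h2] := br_right br Kk (ltW sk).
have Kl := br_lo br s; have Kh := br_hi br s.
have [_ cl] := close (lo s) l1 (le_trans l2 (ltW sk)).
have [_ ch] := close (hi s) (le_trans ts h1) h2.
apply: H2 => //; apply: lt_le_trans h1; rewrite lt_neqAle l2 andbT.
by apply: contra_notN nKs => /eqP <-.
Qed.

Lemma glues_along_opp (K : set R) U u : glues_along K U u ->
  glues_along [set k | K (- k)] (fun c d s => U (- d) (- c) (- s)) (fun s => u (- s)).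
Proof.
case=> Uc Uend uc Usmall; split.
- move=> c d s; apply: (@continuous_comp _ _ _ -%R (U (- d) (- c))); last exact: Uc.
  exact: oppr_continuous.
- by move=> c d Kc Kd cd; have [|-> ->] := Uend _ _ Kd Kc; rewrite ?lerN2.
- move=> t Kt e e0; have [r r0 H] := uc _ Kt e e0; exists r => // s Ks st.
  by apply: H => //; rewrite -opprD normrN.
- move=> t Kt e e0; have [r r0 H] := Usmall _ Kt e e0; exists r => //.
  move=> c d s Kc Kd cd cs sd ct dt; apply: H; rewrite ?lerN2 ?ltrN2 //.
    by rewrite -opprD normrN.
  by rewrite -opprD normrN.
Qed.

Lemma glue_left (K : set R) lo hi U u : brackets K lo hi -> glues_along K U u ->
  forall t, K t -> forall e, 0 < e -> exists2 r, 0 < r & forall s, s <= t -> t - r < s ->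
    `|U (lo s) (hi s) s - u t| <= e.
Proof.
move=> br gl t Kt e e0.
have [|r r0 H] := glue_right (brackets_opp br) (glues_along_opp gl) (t := - t) _ e0.
  by rewrite /= opprK.
exists r => // s st ts; have := H (- s); rewrite !opprK; apply; first by rewrite lerN2.
by rewrite ltrNl opprD opprK.
Qed.

Lemma locally_constant_brackets (K : set R) lo hi t : closed K -> brackets K lo hi -> ~ K t ->
  exists2 r, 0 < r & forall s, `|s - t| < r -> lo s = lo t /\ hi s = hi t.
Proof.
move=> cK br nKt; have : open_nbhs t (~` K) by split => //; exact: closed_openC.
move=> /open_nbhs_nbhs/nbhs_ballP[r /= r0 Hr]; exists r => // s st.
have [le_st|/ltW le_ts] := leP s t.
  apply: (br_local br le_st) => k /andP[sk kt]; apply: Hr.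
  by move: st; rewrite /ball /= ler0_norm ?subr_le0 // ger0_norm ?subr_ge0 //; lra.
have [|-> ->//] := br_local br le_ts; move=> k /andP[sk kt]; apply: Hr.
by move: st; rewrite /ball /= ger0_norm ?subr_ge0 // ler0_norm ?subr_le0 //; lra.
Qed.

Lemma glue_continuous (K : set R) lo hi U u : closed K -> brackets K lo hi ->
  glues_along K U u -> continuous (fun s => U (lo s) (hi s) s).
Proof.
move=> cK br gl t; have [Uc Uend _ _] := gl.
apply/cvgrPdist_le => e e0; apply/nbhs_ballP.
have [Kt|nKt] := pselect (K t).
  have [r1 r10 H1] := glue_right br gl Kt e0.
  have [r2 r20 H2] := glue_left br gl Kt e0.
  have -> : U (lo t) (hi t) t = u t.
    by have [-> ->] := br_id br Kt; have [] := Uend t t Kt Kt (lexx t).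
  exists (Num.min r1 r2) => /=; first by rewrite lt_min r10.
  move=> s; rewrite /ball /= lt_min => /andP[s1 s2]; rewrite distrC.
  have [le_st|/ltW le_ts] := leP s t.
    by apply: H2 => //; move: s2; rewrite ltr_distl => /andP[]; lra.
  by apply: H1 => //; move: s1; rewrite ltr_distl => /andP[]; lra.
have [r r0 H] := locally_constant_brackets cK br nKt.
have /cvgrPdist_le /(_ e e0) /nbhs_ballP[r' /= r'0 Hr'] := Uc (lo t) (hi t) t.
exists (Num.min r r') => /=; first by rewrite lt_min r0.
move=> s; rewrite /ball /= lt_min => /andP[s1 s2].
by have [|-> ->] := H s; [rewrite distrC|exact: Hr'].
Qed.

(** Since the derivative u is already known to be continuous, at a point of K
    it suffices to have difference quotients along K: the rest of the
    increment is covered inside one gap, by the mean value theorem. *)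
Lemma glue_derive (K : set R) lo hi (G U : R -> R -> R -> R) (x : R -> R) (t : R) :
  closed K -> brackets K lo hi ->
  (forall c d s : R, is_derive s 1 (G c d) (U c d s)) ->
  (forall c d, K c -> K d -> c <= d -> G c d c = x c /\ G c d d = x d) ->
  let u s := U (lo s) (hi s) s in
  continuous u ->
  (K t -> forall e, 0 < e -> exists2 r, 0 < r & forall s, K s -> `|s - t| < r ->
     `|x s - x t - (s - t) * u t| <= e * `|s - t|) ->
  is_derive t 1 (fun s => G (lo s) (hi s) s) (u t).
Proof.
move=> cK br Gd Gend u uc xK.
have [Kt|nKt] := pselect (K t); last first.
  have [r r0 H] := locally_constant_brackets cK br nKt.
  apply: (@near_eq_is_derive _ _ _ (G (lo t) (hi t))).
  by apply/nbhs_ballP; exists r => //= s; rewrite /ball /= distrC => /H[-> ->].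
apply/is_deriveP => e e0.
have [r1 r10 H1] := xK Kt e e0.
have /cvgrPdist_le /(_ e e0) /nbhs_ballP[r2 /= r20 H2] := uc t.
have GK s : K s -> G (lo s) (hi s) s = x s.
  by move=> Ks; have [-> ->] := br_id br Ks; have [] := Gend s s Ks Ks (lexx s).
have Gc c d : continuous (G c d) by move=> s; exact: is_derive_cts (Gd c d s).
exists (Num.min r1 r2); first by rewrite lt_min r10.
move=> s; rewrite lt_min => /andP[s1 s2]; rewrite (GK t) //.
have [Ks|nKs] := pselect (K s); first by rewrite GK //; exact: H1.
have Kl := br_lo br s; have Kh := br_hi br s.
have [Gl Gh] := Gend _ _ Kl Kh (br_lohi br s).
have us y : `|y - t| < r2 -> `|u y - u t| <= e.
  by move=> yt; rewrite distrC; apply: H2; rewrite /ball /= distrC.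
(* from t to the end of the gap that is nearer to t, then from there to s *)
have [le_st|le_ts] := leP s t.
  have [sh ht] := br_right br Kt le_st.
  have {}sh : s < hi s by rewrite lt_neqAle sh andbT; apply: contra_notN nKs => /eqP ->.
  have [y] := MVT sh (fun y _ => Gd (lo s) (hi s) y) (continuous_subspaceT (Gc _ _)).
  rewrite in_itv /= => /andP[sy yh] MV.
  have [l1 h1] : lo y = lo s /\ hi y = hi s.
    have [|-> -> //] := br_local br (ltW sy); move=> k /andP[sk ky] Kk.
    by have [_] := br_right br Kk sk; rewrite leNgt (le_lt_trans ky).
  have uy : U (lo s) (hi s) y = u y by rewrite /u l1 h1.
  rewrite uy Gh in MV.
  have st : `|s - t| = t - s by rewrite ler0_norm ?subr_le0 // opprB.
  have hst : `|hi s - t| = t - hi s by rewrite ler0_norm ?subr_le0 // opprB.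
  have X1 : `|x (hi s) - x t - (hi s - t) * u t| <= e * (t - hi s).
    by rewrite -hst; apply: H1 => //; rewrite hst; rewrite st in s1; lra.
  have X2 : `|u y - u t| * (hi s - s) <= e * (hi s - s).
    rewrite ler_wpM2r ?subr_ge0 ?(ltW sh) //; apply: us.
    by rewrite ler0_norm ?subr_le0; rewrite st in s2; lra.
  have -> : G (lo s) (hi s) s - x t - (s - t) *: u t =
      (x (hi s) - x t - (hi s - t) * u t) - (u y - u t) * (hi s - s).
    have -> : G (lo s) (hi s) s = x (hi s) - u y * (hi s - s) by rewrite -MV; ring.
    by rewrite [_ *: _]mulrC; ring.
  apply: (le_trans (ler_normB _ _)); rewrite normrM (ger0_norm (x := hi s - s)) ?subr_ge0 ?(ltW sh) //.
  by apply: (le_trans (lerD X1 X2)); rewrite st; lra.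
have [tl ls] := br_left br Kt (ltW le_ts).
have {}ls : lo s < s by rewrite lt_neqAle ls andbT; apply: contra_notN nKs => /eqP <-.
have [y] := MVT ls (fun y _ => Gd (lo s) (hi s) y) (continuous_subspaceT (Gc _ _)).
rewrite in_itv /= => /andP[ly ys] MV.
have [l1 h1] : lo y = lo s /\ hi y = hi s.
  apply: (br_local br (ltW ys)) => k /andP[yk ks] Kk.
  by have [+ _] := br_left br Kk ks; rewrite leNgt (lt_le_trans ly).
have uy : U (lo s) (hi s) y = u y by rewrite /u l1 h1.
rewrite uy Gl in MV.
have st : `|s - t| = s - t by rewrite ger0_norm // subr_ge0 ltW.
have lst : `|lo s - t| = lo s - t by rewrite ger0_norm // subr_ge0.
have X1 : `|x (lo s) - x t - (lo s - t) * u t| <= e * (lo s - t).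
  by rewrite -[X in e * X]lst; apply: H1 => //; rewrite lst; rewrite st in s1; lra.
have X2 : `|u y - u t| * (s - lo s) <= e * (s - lo s).
  rewrite ler_wpM2r ?subr_ge0 ?(ltW ls) //; apply: us.
  by rewrite ger0_norm ?subr_ge0; rewrite st in s2; lra.
have -> : G (lo s) (hi s) s - x t - (s - t) *: u t =
    (x (lo s) - x t - (lo s - t) * u t) + (u y - u t) * (s - lo s).
  have -> : G (lo s) (hi s) s = x (lo s) + u y * (s - lo s) by rewrite -MV; ring.
  by rewrite [_ *: _]mulrC; ring.
apply: (le_trans (ler_normD _ _)); rewrite normrM (ger0_norm (x := s - lo s)) ?subr_ge0 ?(ltW ls) //.
by apply: (le_trans (lerD X1 X2)); rewrite st; lra.
Qed.

End Brackets.

(** * Whitney extension of horizontal jets *)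

Section Whitney.
Context {R : realType}.

(** The compatibility conditions of jets along K: displacements between nearby
    points c and d are those of a constant control, up to errors negligible
    with respect to d - c raised to the homogeneous degree. *)
Definition whitney_jets (K : set R) (J : R -> jet R) :=
  forall e : R, 0 < e -> exists2 r, 0 < r & forall c d, K c -> K d -> c < d -> d - c < r ->
    [/\ `|ju1 (J d) - ju1 (J c)| <= e /\ `|ju2 (J d) - ju2 (J c)| <= e,
        `|disp1 (J c) (J d) / (d - c) - ju1 (J c)| <= e,
        `|disp2 (J c) (J d) / (d - c) - ju2 (J c)| <= e,
        `|disp3 (J c) (J d) / (d - c) ^+ 2 - ju1 (J c) * ju2 (J c) / 2| <= e &
        `|disp4 (J c) (J d) / (d - c) ^+ 3 - ju1 (J c) ^+ 2 * ju2 (J c) / 6| <= e].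

Variables (K : set R) (J : R -> jet R).
Hypothesis cK : closed K.
Hypothesis K0 : K !=set0.
Hypothesis u1_neq0 : forall t, K t -> ju1 (J t) != 0.
Hypothesis WJ : whitney_jets K J.

(** The filter of pairs c < d of points of K close to t, with a third point s
    between them. *)
Definition shrinking (t : R) : set_system (R * R * R) :=
  within [set p | [/\ K p.1.1, K p.1.2 & [/\ p.1.1 < p.1.2, p.1.1 <= p.2 & p.2 <= p.1.2]]]
    (nbhs (t, t, t)).

Lemma shrinkingP (t : R) (A : set (R * R * R)) : shrinking t A <->
  exists2 r, 0 < r & forall c d s, K c -> K d -> c < d -> c <= s -> s <= d ->
    `|c - t| < r -> `|d - t| < r -> A (c, d, s).
Proof.
rewrite /shrinking /=; split=> [/nbhs_ballP[r /= r0 H]|[r r0 H]].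
  exists r => // c d s Kc Kd cd cs sd ct dt; apply: H => //; split => /=.
    by split; rewrite /ball /= distrC.
  rewrite /ball /= distrC; move: ct dt; rewrite !ltr_distl => /andP[? ?] /andP[? ?].
  by apply/andP; split; lra.
apply/nbhs_ballP; exists r => //= -[[c d] s] [[/= ct dt] st] [Kc Kd [cd cs sd]].
by apply: H => //; rewrite distrC.
Qed.

Section AtPoint.
Variables (t : R) (Kt : K t).
Let F := shrinking t.
Let FF : Filter F. Proof. exact: within_filter. Qed.

Lemma cvg_shrinking (f : R * R * R -> R) l :
  (forall e, 0 < e -> exists2 r, 0 < r & forall c d s, K c -> K d -> c < d -> c <= s -> s <= d ->
    `|c - t| < r -> `|d - t| < r -> `|f (c, d, s) - l| <= e) <-> f @ F --> l.
Proof.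
split=> [H|/cvgrPdist_le H e e0].
  apply/cvgrPdist_le => e e0; apply/shrinkingP; have [r r0 Hr] := H e e0.
  by exists r => // c d s *; rewrite distrC; exact: Hr.
have /shrinkingP[r r0 Hr] := H e e0.
by exists r => // c d s *; rewrite distrC; exact: Hr.
Qed.

Lemma shrinking_length : (fun p : R * R * R => p.1.2 - p.1.1) @ F --> (0 : R).
Proof.
apply/cvg_shrinking => e e0; exists (e / 2); first by rewrite divr_gt0.
move=> c d s _ _ cd _ _ /=; rewrite !ltr_distl subr0 => /andP[? ?] /andP[? ?].
by rewrite ger0_norm; lra.
Qed.

Lemma jets_continuous_along :
  (forall e, 0 < e -> exists2 r, 0 < r & forall s, K s -> `|s - t| < r ->
    `|ju1 (J s) - ju1 (J t)| <= e) /\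
  (forall e, 0 < e -> exists2 r, 0 < r & forall s, K s -> `|s - t| < r ->
    `|ju2 (J s) - ju2 (J t)| <= e).
Proof.
split=> e e0; have [r r0 H] := WJ e0; exists r => // s Ks; have [st|ts|->] := ltgtP s t;
  rewrite ?subrr ?normr0 ?(ltW e0) //.
- by rewrite distrC => h; rewrite distrC; have [[]] := H s t Ks Kt st (le_lt_trans (ler_norm _) h).
- by move=> h; have [[]] := H t s Kt Ks ts (le_lt_trans (ler_norm _) h).
- by rewrite distrC => h; rewrite distrC; have [[]] := H s t Ks Kt st (le_lt_trans (ler_norm _) h).
- by move=> h; have [[]] := H t s Kt Ks ts (le_lt_trans (ler_norm _) h).
Qed.

Lemma cvg_ju1 : (fun p => ju1 (J p.1.1)) @ F --> ju1 (J t) /\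
  (fun p => ju1 (J p.1.2)) @ F --> ju1 (J t).
Proof.
split; apply/cvg_shrinking => e e0; have [r r0 H] := jets_continuous_along.1 e e0;
  exists r => // c d s Kc Kd *; exact: H.
Qed.

Lemma cvg_ju2 : (fun p => ju2 (J p.1.1)) @ F --> ju2 (J t) /\
  (fun p => ju2 (J p.1.2)) @ F --> ju2 (J t).
Proof.
split; apply/cvg_shrinking => e e0; have [r r0 H] := jets_continuous_along.2 e e0;
  exists r => // c d s Kc Kd *; exact: H.
Qed.

(** The estimates of whitney_jets compare with the jet at c, which converges to
    the jet at t. *)
Lemma cvg_from_base (f g : R * R * R -> R) (l : R) : g @ F --> l ->
  (forall e, 0 < e -> exists2 r, 0 < r & forall c d s, K c -> K d -> c < d -> d - c < r ->
    `|f (c, d, s) - g (c, d, s)| <= e) -> f @ F --> l.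
Proof.
move=> gl H; have -> : f = (fun p => (f p - g p) + g p) by apply/funext => p; rewrite subrK.
rewrite -[l]add0r; apply: cvg_funD gl; apply/cvg_shrinking => e e0.
have [r r0 Hr] := H e e0; exists (r / 2); first by rewrite divr_gt0.
move=> c d s Kc Kd cd _ _; rewrite !ltr_distl => /andP[? ?] /andP[? ?]; rewrite subr0.
by apply: Hr => //; lra.
Qed.

Lemma cvg_disp1 : (fun p => disp1 (J p.1.1) (J p.1.2) / (p.1.2 - p.1.1)) @ F --> ju1 (J t).
Proof.
apply: cvg_from_base cvg_ju1.1 _ => e e0; have [r r0 H] := WJ e0; exists r => // c d s Kc Kd cd cdr.
by have [] := H c d Kc Kd cd cdr.
Qed.

Lemma cvg_disp2 : (fun p => disp2 (J p.1.1) (J p.1.2) / (p.1.2 - p.1.1)) @ F --> ju2 (J t).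
Proof.
apply: cvg_from_base cvg_ju2.1 _ => e e0; have [r r0 H] := WJ e0; exists r => // c d s Kc Kd cd cdr.
by have [] := H c d Kc Kd cd cdr.
Qed.

Lemma cvg_disp3 : (fun p => disp3 (J p.1.1) (J p.1.2) / (p.1.2 - p.1.1) ^+ 2) @ F -->
  ju1 (J t) * ju2 (J t) / 2.
Proof.
apply: (@cvg_from_base _ (fun p => ju1 (J p.1.1) * ju2 (J p.1.1) / 2)).
  apply: cvg_funM; last exact: cvg_cst.
  by apply: cvg_funM; [exact: cvg_ju1.1|exact: cvg_ju2.1].
move=> e e0; have [r r0 H] := WJ e0; exists r => // c d s Kc Kd cd cdr.
by have [] := H c d Kc Kd cd cdr.
Qed.

Lemma cvg_disp4 : (fun p => disp4 (J p.1.1) (J p.1.2) / (p.1.2 - p.1.1) ^+ 3) @ F -->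
  ju1 (J t) ^+ 2 * ju2 (J t) / 6.
Proof.
apply: (@cvg_from_base _ (fun p => ju1 (J p.1.1) ^+ 2 * ju2 (J p.1.1) / 6)).
  apply: cvg_funM; last exact: cvg_cst.
  by apply: cvg_funM; [apply: cvg_funM; exact: cvg_ju1.1|exact: cvg_ju2.1].
move=> e e0; have [r r0 H] := WJ e0; exists r => // c d s Kc Kd cd cdr.
by have [] := H c d Kc Kd cd cdr.
Qed.

(** Limits over pairs around t bound the difference quotients at t itself. *)
Lemma derive_along (x : R -> R) (l : R) :
  (fun p => (x p.1.2 - x p.1.1) / (p.1.2 - p.1.1)) @ F --> l ->
  forall e, 0 < e -> exists2 r, 0 < r & forall s, K s -> `|s - t| < r ->
    `|x s - x t - (s - t) * l| <= e * `|s - t|.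
Proof.
move=> /cvg_shrinking H e e0; have [r r0 Hr] := H e e0; exists r => // s Ks.
have [st sr|ts sr|-> _] := ltgtP s t; last by rewrite !subrr mul0r subrr normr0 mulr0.
- have := Hr s t s Ks Kt st (lexx s) (ltW st) sr; rewrite subrr normr0 => /(_ r0) /=.
  have ts0 : 0 < t - s by rewrite subr_gt0.
  rewrite (distrC s t) (ger0_norm (ltW ts0)) -ler_pdivrMr //.
  rewrite -[X in _ / X <= _](ger0_norm (ltW ts0)) -normf_div.
  by rewrite (_ : (x s - x t - (s - t) * l) / (t - s) = - ((x t - x s) / (t - s) - l))
    ?normrN //; field; rewrite gt_eqF.
- have := Hr t s s Kt Ks ts (ltW ts) (lexx s); rewrite subrr normr0 => /(_ r0 sr) /=.
  have ts0 : 0 < s - t by rewrite subr_gt0.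
  rewrite (ger0_norm (ltW ts0)) -ler_pdivrMr //.
  rewrite -[X in _ / X <= _](ger0_norm (ltW ts0)) -normf_div.
  by rewrite (_ : (x s - x t - (s - t) * l) / (s - t) = (x s - x t) / (s - t) - l)
    //; field; rewrite gt_eqF.
Qed.

Lemma cvg_jx1 : (fun p => jx1 (J p.1.1)) @ F --> jx1 (J t).
Proof.
apply/cvg_shrinking => e e0.
have [r r0 H] := derive_along (x := fun s => jx1 (J s)) cvg_disp1 ltr01.
pose M := 1 + `|ju1 (J t)|; have M0 : 0 < M by rewrite ltr_pwDl.
exists (Num.min r (e / M)); first by rewrite lt_min r0 divr_gt0.
move=> c d s Kc _ _ _ _; rewrite lt_min ltr_pdivlMr // => /andP[cr cM] _ /=.
have := H c Kc cr; rewrite mul1r => h.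
rewrite -[_ - _](subrK ((c - t) * ju1 (J t))); apply: (le_trans (ler_normD _ _)).
rewrite normrM; apply: le_trans (ltW cM); rewrite /M mulrDr mulr1.
by rewrite lerD.
Qed.

Let len_neq0 : \forall p \near F, p.1.2 - p.1.1 != 0 :> R.
Proof.
by apply/shrinkingP; exists 1 => // c d s _ _ cd *; rewrite /= subr_eq0 gt_eqF.
Qed.

(** The second order displacement is negligible at first order, which leaves
    the horizontality relation dx3 = x1 dx2. *)
Lemma cvg_x3 : (fun p => (jx3 (J p.1.2) - jx3 (J p.1.1)) / (p.1.2 - p.1.1)) @ F -->
  jx1 (J t) * ju2 (J t).
Proof.
have E : \forall p \near F, jx1 (J p.1.1) * (disp2 (J p.1.1) (J p.1.2) / (p.1.2 - p.1.1)) +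
    disp3 (J p.1.1) (J p.1.2) / (p.1.2 - p.1.1) ^+ 2 * (p.1.2 - p.1.1) =
    (jx3 (J p.1.2) - jx3 (J p.1.1)) / (p.1.2 - p.1.1).
  by apply: filterS len_neq0 => p p0; rewrite /disp2 /disp3; field.
apply: cvg_trans (near_eq_cvg E) _.
have -> : jx1 (J t) * ju2 (J t) = jx1 (J t) * ju2 (J t) + ju1 (J t) * ju2 (J t) / 2 * 0 by ring.
apply: cvg_funD; first by apply: cvg_funM; [exact: cvg_jx1|exact: cvg_disp2].
by apply: cvg_funM; [exact: cvg_disp3|exact: shrinking_length].
Qed.

Lemma cvg_x4 : (fun p => (jx4 (J p.1.2) - jx4 (J p.1.1)) / (p.1.2 - p.1.1)) @ F -->
  jx1 (J t) ^+ 2 / 2 * ju2 (J t).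
Proof.
have E : \forall p \near F, jx1 (J p.1.1) * ((jx3 (J p.1.2) - jx3 (J p.1.1)) / (p.1.2 - p.1.1))
    - jx1 (J p.1.1) * jx1 (J p.1.1) / 2 * (disp2 (J p.1.1) (J p.1.2) / (p.1.2 - p.1.1))
    + disp4 (J p.1.1) (J p.1.2) / (p.1.2 - p.1.1) ^+ 3 * ((p.1.2 - p.1.1) * (p.1.2 - p.1.1)) =
    (jx4 (J p.1.2) - jx4 (J p.1.1)) / (p.1.2 - p.1.1).
  by apply: filterS len_neq0 => p p0; rewrite /disp2 /disp4; field.
apply: cvg_trans (near_eq_cvg E) _.
have -> : jx1 (J t) ^+ 2 / 2 * ju2 (J t) = jx1 (J t) * (jx1 (J t) * ju2 (J t))
    - jx1 (J t) * jx1 (J t) / 2 * ju2 (J t) + (ju1 (J t) ^+ 2 * ju2 (J t) / 6) * (0 * 0) by field.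
have h1 := cvg_jx1; have h2 := cvg_disp2; have h3 := cvg_x3; have h4 := cvg_disp4.
have h0 := shrinking_length.
apply: cvg_funD; last by apply: cvg_funM => //; exact: cvg_funM.
apply: cvg_funB; first exact: cvg_funM.
apply: cvg_funM => //; apply: cvg_funM; last exact: cvg_cst.
exact: cvg_funM.
Qed.

Lemma cvg_gap_controls :
  [/\ \forall p \near F, jx1 (J p.1.1) != jx1 (J p.1.2),
    (fun p => gap_u1 p.1.1 p.1.2 (J p.1.1) (J p.1.2) p.2) @ F --> ju1 (J t) &
    (fun p => gap_u2 p.1.1 p.1.2 (J p.1.1) (J p.1.2) p.2) @ F --> ju2 (J t)].
Proof.
have csd : \forall p \near F, [/\ p.1.1 < p.1.2, p.1.1 <= p.2 & p.2 <= p.1.2].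
  by apply/shrinkingP; exists 1.
have v0 := u1_neq0 Kt; have [a1 a2] := cvg_ju1; have [b1 b2] := cvg_ju2.
have h1 := cvg_disp1; have h2 := cvg_disp2; have h3 := cvg_disp3; have h4 := cvg_disp4.
split.
- exact: (near_gap_neq (c := fun p => p.1.1) (d := fun p => p.1.2) v0).
- exact: (cvg_gap_u1 csd a1 a2 h1).
- exact: (cvg_gap_u2 v0 csd a1 a2 b1 b2 h1 h2 h3 h4).
Qed.

End AtPoint.

(** A closed set of compatible jets transversal to X2 lies on a C1 horizontal
    curve.  One arc is chosen for each pair of points of K, a line when the two
    coincide; gluing x1 and x2 gives the continuity of x1 and u2, which the
    derivatives of x3 and x4 involve. *)
Theorem whitney_arc : exists A : arc R, forall t, K t -> jet_of A t = J t.
Proof.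
have [lo [hi br]] := brackets_exist cK K0.
have /choice[AA HAA] : forall cd : R * R, exists A : arc R, K cd.1 -> K cd.2 -> cd.1 <= cd.2 ->
    [/\ jet_of A cd.1 = J cd.1, jet_of A cd.2 = J cd.2 &
      cd.1 < cd.2 -> jx1 (J cd.1) != jx1 (J cd.2) -> forall s,
        au1 A s = gap_u1 cd.1 cd.2 (J cd.1) (J cd.2) s /\
        au2 A s = gap_u2 cd.1 cd.2 (J cd.1) (J cd.2) s].
  move=> [c d] /=; have [Kc|nKc] := pselect (K c); last first.
    by have [A _] := line_arc (J c) c; exists A.
  have [Kd|nKd] := pselect (K d); last first.
    by have [A _] := line_arc (J c) c; exists A.
  have [cd|dc|->] := ltgtP c d.
  - have [A [h1 h2 h3]] := connecting_arc cd (u1_neq0 Kc) (u1_neq0 Kd).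
    by exists A => _ _ _; split => // _; exact: h3.
  - by have [A _] := line_arc (J c) c; exists A.
  - by have [A h] := line_arc (J d) d; exists A => _ _ _; split => //; rewrite ltxx.
pose A c d := AA (c, d).
have AE c d : K c -> K d -> c <= d -> jet_of (A c d) c = J c /\ jet_of (A c d) d = J d.
  by move=> Kc Kd cd; have [] := HAA (c, d) Kc Kd cd.
have Aend (T : Type) (f : jet R -> T) c d : K c -> K d -> c <= d ->
    f (jet_of (A c d) c) = f (J c) /\ f (jet_of (A c d) d) = f (J d).
  by move=> Kc Kd cd; have [-> ->] := AE c d Kc Kd cd.
have gl1 : glues_along K (fun c d => au1 (A c d)) (fun t => ju1 (J t)).
  split=> [c d|c d|t Kt|t Kt e e0].
  - exact: au1_continuous.
  - exact: (Aend _ (@ju1 R)).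
  - exact: (jets_continuous_along Kt).1.
  - have [/shrinkingP[r1 r10 H1] /cvg_shrinking H _] := cvg_gap_controls Kt.
    have [r2 r20 H2] := H e e0; exists (Num.min r1 r2); first by rewrite lt_min r10.
    move=> c d s Kc Kd cd cs sd; rewrite !lt_min => /andP[c1 c2] /andP[d1 d2].
    have [_ _ /(_ cd (H1 c d s Kc Kd cd cs sd c1 d1) s)[-> _]] := HAA (c, d) Kc Kd (ltW cd).
    exact: H2.
have gl2 : glues_along K (fun c d => au2 (A c d)) (fun t => ju2 (J t)).
  split=> [c d|c d|t Kt|t Kt e e0].
  - exact: au2_continuous.
  - exact: (Aend _ (@ju2 R)).
  - exact: (jets_continuous_along Kt).2.
  - have [/shrinkingP[r1 r10 H1] _ /cvg_shrinking H] := cvg_gap_controls Kt.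
    have [r2 r20 H2] := H e e0; exists (Num.min r1 r2); first by rewrite lt_min r10.
    move=> c d s Kc Kd cd cs sd; rewrite !lt_min => /andP[c1 c2] /andP[d1 d2].
    have [_ _ /(_ cd (H1 c d s Kc Kd cd cs sd c1 d1) s)[_ ->]] := HAA (c, d) Kc Kd (ltW cd).
    exact: H2.
have C1 := glue_continuous cK br gl1; have C2 := glue_continuous cK br gl2.
pose g (f : arc R -> R -> R) s := f (A (lo s) (hi s)) s.
have gK f (j : jet R -> R) : (forall B s, f B s = j (jet_of B s)) -> forall t, K t -> g f t = j (J t).
  move=> fj t Kt; rewrite /g fj; have [-> ->] := br_id br Kt.
  by have [-> _] := AE t t Kt Kt (lexx t).
have g1 := gK (@ax1 R) (@jx1 R) (fun _ _ => erefl).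
have k1 := gK (@au1 R) (@ju1 R) (fun _ _ => erefl).
have k2 := gK (@au2 R) (@ju2 R) (fun _ _ => erefl).
have D1 (t : R) : is_derive t 1 (g (@ax1 R)) (g (@au1 R) t).
  apply: (@glue_derive _ K lo hi (fun c d => ax1 (A c d)) (fun c d => au1 (A c d))
    (fun t => jx1 (J t)) t cK br (fun c d s => ax1_derive _ s) (Aend _ (@jx1 R)) C1) => Kt.
  by have := derive_along Kt (x := fun s => jx1 (J s)) (cvg_disp1 Kt); rewrite -k1.
have D2 (t : R) : is_derive t 1 (g (@ax2 R)) (g (@au2 R) t).
  apply: (@glue_derive _ K lo hi (fun c d => ax2 (A c d)) (fun c d => au2 (A c d))
    (fun t => jx2 (J t)) t cK br (fun c d s => ax2_derive _ s) (Aend _ (@jx2 R)) C2) => Kt.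
  by have := derive_along Kt (x := fun s => jx2 (J s)) (cvg_disp2 Kt); rewrite -k2.
have C3 : continuous (g (fun B s => ax1 B s * au2 B s)).
  by move=> t; apply: (cvg_funM (f := g (@ax1 R)) (g := g (@au2 R)));
    [exact: is_derive_cts (D1 t)|exact: C2].
have C4 : continuous (g (fun B s => ax1 B s ^+ 2 / 2 * au2 B s)).
  move=> t; apply: (cvg_funM (f := fun s => g (@ax1 R) s * g (@ax1 R) s / 2) (g := g (@au2 R)));
    last exact: C2.
  by apply: cvg_funM; [apply: cvg_funM; exact: is_derive_cts (D1 t)|exact: cvg_cst].
have D3 (t : R) : is_derive t 1 (g (@ax3 R)) (g (@ax1 R) t * g (@au2 R) t).
  apply: (@glue_derive _ K lo hi (fun c d => ax3 (A c d)) (fun c d s => ax1 (A c d) s * au2 (A c d) s)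
    (fun t => jx3 (J t)) t cK br (fun c d s => ax3_derive _ s) (Aend _ (@jx3 R)) C3) => Kt.
  have := derive_along Kt (x := fun s => jx3 (J s)) (cvg_x3 Kt).
  by rewrite -k2 // -g1.
have D4 (t : R) : is_derive t 1 (g (@ax4 R)) (g (@ax1 R) t ^+ 2 / 2 * g (@au2 R) t).
  apply: (@glue_derive _ K lo hi (fun c d => ax4 (A c d))
    (fun c d s => ax1 (A c d) s ^+ 2 / 2 * au2 (A c d) s)
    (fun t => jx4 (J t)) t cK br (fun c d s => ax4_derive _ s) (Aend _ (@jx4 R)) C4) => Kt.
  have := derive_along Kt (x := fun s => jx4 (J s)) (cvg_x4 Kt).
  by rewrite -k2 // -g1.
exists (Arc C1 C2 D1 D2 D3 D4) => t Kt; rewrite /jet_of /= g1 // -/(g (@au1 R) t) -/(g (@au2 R) t) k1 // k2 //.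
rewrite (gK (@ax2 R) (@jx2 R)) // (gK (@ax3 R) (@jx3 R)) // (gK (@ax4 R) (@jx4 R)) //.
by case: (J t).
Qed.

End Whitney.

(** * Whitney sets of large measure *)

Section LargeWhitneySet.
Context {R : realType}.
Notation mu := (@lebesgue_measure R).
Variables (a b : R) (x1 x2 x3 x4 u1 u2 : R -> R) (N : set R).
Hypothesis ab : a < b.
Hypothesis x1_ac : absolutely_continuous a b x1.
Hypothesis x2_ac : absolutely_continuous a b x2.
Hypothesis x3_ac : absolutely_continuous a b x3.
Hypothesis x4_ac : absolutely_continuous a b x4.
Hypothesis N0 : mu.-negligible N.
Hypothesis x1_der : forall s, a <= s <= b -> ~ N s -> is_derive s 1 x1 (u1 s).
Hypothesis x2_der : forall s, a <= s <= b -> ~ N s -> is_derive s 1 x2 (u2 s).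
Hypothesis x3_der : forall s, a <= s <= b -> ~ N s -> is_derive s 1 x3 (x1 s * u2 s).
Hypothesis x4_der : forall s, a <= s <= b -> ~ N s -> is_derive s 1 x4 (x1 s ^+ 2 / 2 * u2 s).

Let J t := Jet (x1 t) (x2 t) (x3 t) (x4 t) (u1 t) (u2 t).

(* The curve is frozen outside [a, b], so that the quotients are continuous on
   the whole line. *)
Let y (x : R -> R) := x \o clamp a b.

Let y_cts x : absolutely_continuous a b x -> continuous (y x).
Proof.
by move=> xac; apply: continuous_comp_clamp (ltW ab) _; exact: absolutely_continuous_continuous.
Qed.

Let yE x t : a <= t <= b -> y x t = x t.
Proof. by move=> tab; rewrite /y /= clamp_id. Qed.

(** The form shared by the quotients of all orders, n = 1 included. *)
Lemma cvg_quotient (num : R -> R) s t n : s != t -> {for t, continuous num} ->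
  {for t, continuous (fun t => num t / (s - t) ^+ n)}.
Proof.
move=> st numc; apply: cvg_funM => //; apply: cvg_funV.
  by rewrite expf_neq0 // subr_eq0.
apply: (@continuous_comp _ _ _ (fun t => s - t) (fun h => h ^+ n)); last exact: exprn_continuous.
by apply: cvg_funB; [exact: cvg_cst|exact: cvg_id].
Qed.

(** Four applications of uniform_limit_off_small_set, one for each displacement,
    and an open neighbourhood of the exceptional points to be avoided.
    Continuity of u1 and u2 along the set comes from the symmetry of the first
    order quotient in its two points. *)
Lemma large_whitney_set eps : 0 < eps -> exists K : set R,
  [/\ closed K, K `<=` `[a, b]%classic, K `&` N = set0,
      (mu (`[a, b]%classic `\` K) <= eps%:E)%E & whitney_jets K J].
Proof.
move=> eps0.
have [V [V_nd V_x2 V_steep]] := absolutely_continuous_variation_bound ab x2_ac.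
set St := (X in _.-negligible X) in V_steep.
pose N' := N `|` St.
have N'0 : mu.-negligible N' by exact: negligibleU.
have nsteep t : a <= t <= b -> ~ N' t -> exists M d0, 0 < d0 /\
    forall s, 0 < `|s - t| < d0 -> `|V s - V t| <= M * `|s - t|.
  move=> tab nt; apply: contrapT => H; apply: nt; right; split => // M d d0.
  apply: contrapT => H'; apply: H; exists M, d; split => // s st.
  by rewrite leNgt; apply/negP => h; apply: H'; exists s.
have nN t : ~ N' t -> ~ N t by move=> h Nt; apply: h; left.
pose e5 := eps / 5; have e50 : 0 < e5 by rewrite divr_gt0.
have cy1 := y_cts x1_ac; have cy2 := y_cts x2_ac; have cy3 := y_cts x3_ac; have cy4 := y_cts x4_ac.
pose Q1 (x : R -> R) t s := (y x s - y x t) / (s - t) ^+ 1.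
pose n3 t s := y x3 s - y x3 t - y x1 t * (y x2 s - y x2 t).
pose n4 t s := y x4 s - y x4 t - y x1 t * (y x3 s - y x3 t)
   + y x1 t * y x1 t / 2 * (y x2 s - y x2 t).
pose Q3 t s := n3 t s / (s - t) ^+ 2.
pose Q4 t s := n4 t s / (s - t) ^+ 3.
have cdiff x s t : continuous (y x) -> {for t, continuous (fun t => y x s - y x t)}.
  by move=> cy; apply: cvg_funB; [exact: cvg_cst|exact: cy].
have lim1 x u : (forall s, a <= s <= b -> ~ N s -> is_derive s 1 x (u s)) ->
  forall t, a <= t <= b -> ~ N' t -> forall e, 0 < e -> exists2 d, 0 < d &
     forall s, a <= s <= b -> 0 < `|s - t| < d -> `|Q1 x t s - u t| <= e.
  move=> xd t tab nt e e0; have [d d0 H] := (is_deriveP _ _ _).1 (xd t tab (nN t nt)) e e0.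
  exists d => // s sab /andP[st sd]; have st0 : s - t != 0 by rewrite -normr_gt0.
  have -> : Q1 x t s - u t = (x s - x t - (s - t) * u t) / (s - t).
    by rewrite /Q1 !yE //; field.
  by rewrite normf_div ler_pdivrMr //; exact: H.
have lim3 t : a <= t <= b -> ~ N' t -> forall e, 0 < e -> exists2 d, 0 < d &
     forall s, a <= s <= b -> 0 < `|s - t| < d -> `|Q3 t s - u1 t * u2 t / 2| <= e.
  move=> tab nt e e0; have [M [d0 [d00 VM]]] := nsteep t tab nt.
  have [d dd0 H] := second_order_expansion x2_ac x3_ac V_nd V_x2 N0 x1_der x2_der x3_der
    tab (nN t nt) d00 VM e0.
  exists d => // s sab /andP[st sd]; have st0 : s - t != 0 by rewrite -normr_gt0.
  have -> : Q3 t s - u1 t * u2 t / 2 =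
     (x3 s - x3 t - x1 t * (x2 s - x2 t) - u1 t * u2 t / 2 * (s - t) ^+ 2) / (s - t) ^+ 2.
    by rewrite /Q3 /n3 !yE //; field.
  by rewrite normf_div normrX ler_pdivrMr ?exprn_gt0 //; exact: H.
have lim4 t : a <= t <= b -> ~ N' t -> forall e, 0 < e -> exists2 d, 0 < d &
     forall s, a <= s <= b -> 0 < `|s - t| < d -> `|Q4 t s - u1 t ^+ 2 * u2 t / 6| <= e.
  move=> tab nt e e0; have [M [d0 [d00 VM]]] := nsteep t tab nt.
  have [d dd0 H] := third_order_expansion x2_ac x3_ac x4_ac V_nd V_x2 N0 x1_der x2_der x3_der
    x4_der tab (nN t nt) d00 VM e0.
  exists d => // s sab /andP[st sd]; have st0 : s - t != 0 by rewrite -normr_gt0.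
  have -> : Q4 t s - u1 t ^+ 2 * u2 t / 6 =
     (x4 s - x4 t - x1 t * (x3 s - x3 t) + x1 t ^+ 2 / 2 * (x2 s - x2 t)
       - u1 t ^+ 2 * u2 t / 6 * (s - t) ^+ 3) / (s - t) ^+ 3.
    by rewrite /Q4 /n4 !yE //; field.
  by rewrite normf_div normrX ler_pdivrMr ?exprn_gt0 //; exact: H.
have [K1 [cK1 K1ab mK1 H1]] := uniform_limit_off_small_set e50
  (fun s t st => @cvg_quotient _ s t 1 st (cdiff x1 s t cy1)) N'0 (lim1 x1 u1 x1_der).
have [K2 [cK2 K2ab mK2 H2]] := uniform_limit_off_small_set e50
  (fun s t st => @cvg_quotient _ s t 1 st (cdiff x2 s t cy2)) N'0 (lim1 x2 u2 x2_der).
have cn3 s t : {for t, continuous (n3 ^~ s)}.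
  apply: cvg_funB; first exact: cdiff cy3.
  by apply: cvg_funM; [exact: cy1|exact: cdiff cy2].
have cn4 s t : {for t, continuous (n4 ^~ s)}.
  apply: cvg_funD.
    apply: cvg_funB; first exact: cdiff cy4.
    by apply: cvg_funM; [exact: cy1|exact: cdiff cy3].
  apply: cvg_funM; last exact: cdiff cy2.
  by apply: cvg_funM; [apply: cvg_funM; exact: cy1|exact: cvg_cst].
have [K3 [cK3 K3ab mK3 H3]] := uniform_limit_off_small_set e50
  (fun s t st => @cvg_quotient _ s t 2 st (cn3 s t)) N'0 lim3.
have [K4 [cK4 K4ab mK4 H4]] := uniform_limit_off_small_set e50
  (fun s t st => @cvg_quotient _ s t 3 st (cn4 s t)) N'0 lim4.
have [//|O [Oopen NO mO]] := @outer_measure_open_le R N' e5.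
have /negligible_outer_measure N'0' := N'0.
rewrite N'0' add0e in mO.
pose K := K1 `&` K2 `&` K3 `&` K4 `&` ~` O.
have cK : closed K by apply: closedI; [do 3 (apply: closedI => //)|exact: open_closedC].
have nNK t : K t -> ~ N' t by move=> [_ nO] /NO.
exists K; split => //.
- by move=> t [[[[/K1ab]]]].
- by apply/seteqP; split => // t [/nNK/nN].
- have sub : `[a, b]%classic `\` K `<=` (`[a, b]%classic `\` K1) `|` (`[a, b]%classic `\` K2)
      `|` (`[a, b]%classic `\` K3) `|` (`[a, b]%classic `\` K4) `|` O.
    move=> t [tab nK]; apply: contrapT => nt; apply: nK.
    split; last by move=> Ot; apply: nt; right.
    split; last by apply: contrapT => h; apply: nt; left; right.
    split; last by apply: contrapT => h; apply: nt; left; left; right.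
    by split; apply: contrapT => h; apply: nt; left; left; left; [left|right].
  apply: (le_trans (le_outer_measure mu _ _ sub)).
  have -> : eps%:E = (e5%:E + e5%:E + e5%:E + e5%:E + e5%:E)%E.
    by rewrite -!EFinD; congr EFin; rewrite /e5; field.
  do 4 (apply: (le_trans (outer_measureU2 _ _ _)); apply: leeD => //).
- move=> e e0; have e20 : 0 < e / 2 by rewrite divr_gt0.
  have [r1 r10 {}H1] := H1 _ e20; have [r2 r20 {}H2] := H2 _ e20.
  have [r3 r30 {}H3] := H3 _ e0; have [r4 r40 {}H4] := H4 _ e0.
  exists (Num.min (Num.min r1 r2) (Num.min r3 r4)); first by rewrite !lt_min r10 r20 r30.
  move=> c d Kc Kd cd; rewrite !lt_min => /andP[/andP[d1 d2] /andP[d3 d4]].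
  have [[[[c1 c2] c3] c4] _] := Kc; have [[[[k1 k2] k3] k4] _] := Kd.
  have := K1ab _ c1; have := K1ab _ k1; rewrite /= !in_itv /= => dab cab.
  have cd0 : 0 < d - c by rewrite subr_gt0.
  have ndc : `|d - c| = d - c by rewrite gtr0_norm.
  have ncd : `|c - d| = d - c by rewrite distrC.
  have nc := nNK _ Kc; have nd := nNK _ Kd.
  have A1 : `|Q1 x1 c d - u1 c| <= e / 2 by apply: H1 => //; rewrite ndc cd0.
  have A1' : `|Q1 x1 d c - u1 d| <= e / 2 by apply: H1 => //; rewrite ncd cd0.
  have A2 : `|Q1 x2 c d - u2 c| <= e / 2 by apply: H2 => //; rewrite ndc cd0.
  have A2' : `|Q1 x2 d c - u2 d| <= e / 2 by apply: H2 => //; rewrite ncd cd0.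
  have Qsym x : Q1 x d c = Q1 x c d.
    rewrite /Q1 !expr1; field; rewrite subr_eq0 gt_eqF //=.
    by rewrite subr_eq0 lt_eqF.
  have close (q v w : R) : `|q - v| <= e / 2 -> `|q - w| <= e / 2 -> `|w - v| <= e.
    move=> h1 h2; rewrite -[w](subrK q) -addrA [leRHS]splitr.
    by apply: (le_trans (ler_normD _ _)); rewrite lerD // distrC.
  have e2e : e / 2 <= e by lra.
  have yc x : y x c = x c by exact: yE.
  have yd x : y x d = x d by exact: yE.
  split.
  + split; first by apply: (close (Q1 x1 c d)) => //; rewrite -Qsym.
    by apply: (close (Q1 x2 c d)) => //; rewrite -Qsym.
  + by apply: le_trans e2e; move: A1; rewrite /Q1 expr1 yc yd.
  + by apply: le_trans e2e; move: A2; rewrite /Q1 expr1 yc yd.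
  + have : `|Q3 c d - u1 c * u2 c / 2| <= e by apply: H3 => //; rewrite ndc cd0.
    by rewrite /Q3 /n3 !yc !yd.
  + have : `|Q4 c d - u1 c ^+ 2 * u2 c / 6| <= e by apply: H4 => //; rewrite ndc cd0.
    by rewrite /Q4 /n4 !yc !yd.
Qed.

End LargeWhitneySet.

Section Transversal.
Context {R : realType}.
Notation mu := (@lebesgue_measure R).

Lemma large_transversal_set (K : set R) (J : R -> jet R) (m : \bar R) :
  closed K -> whitney_jets K J ->
  (m < mu (K `&` [set t | ju1 (J t) != 0%R]))%E ->
  exists K' : set R, [/\ closed K', K' `<=` K, (m < mu K')%E,
    (forall t, K' t -> ju1 (J t) != 0) & whitney_jets K' J].
Proof.
move=> cK WJ mK.
pose Kn n := K `&` [set t | n.+1%:R^-1 <= `|ju1 (J t)|].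
have cKn n : closed (Kn n).
  move=> t clt; have Kt : K t.
    by apply: cK; apply: closureS clt; exact: subIsetl.
  split => //=; apply/ler_addgt0Pr => e e0.
  have [r r0 H] := (jets_continuous_along WJ Kt).1 e e0.
  have [|s [[Ks us] st]] := clt (ball t r); first exact: nbhsx_ballx.
  have := H s Ks; rewrite distrC => /(_ st) h.
  apply: (le_trans us); rewrite -[ju1 (J s)](subrK (ju1 (J t))) addrC.
  by apply: (le_trans (ler_normD _ _)); rewrite lerD2l.
have E : K `&` [set t | ju1 (J t) != 0] = \bigcup_n Kn n.
  apply/seteqP; split => [t [Kt ut]|t [n _ [Kt ut]]].
    have u0 : 0 < `|ju1 (J t)| by rewrite normr_gt0.
    near \oo => n; exists n => //; split => //=; apply: ltW.
    by near: n; exact: (near_infty_natSinv_lt (PosNum u0)).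
  split => //=; rewrite -normr_gt0; apply: lt_le_trans ut.
  by rewrite invr_gt0 ltr0n.
have mKn n : measurable (Kn n) by exact: closed_measurable.
have Kcvg : mu (Kn n) @[n --> \oo] --> mu (\bigcup_n Kn n).
  apply: nondecreasing_cvg_mu => //; first exact: bigcupT_measurable.
  move=> n k nk; apply/subsetPset => t [Kt h]; split => //=; apply: le_trans h.
  by rewrite lef_pV2 ?posrE ?ltr0n // ler_nat ltnS.
rewrite E in mK.
have : \forall n \near \oo, (m < mu (Kn n))%E.
  apply: (Kcvg [set x | (m < x)%E]).
  by apply: open_nbhs_nbhs; split; first exact: open_ereal_gt_ereal.
move=> [n _ /(_ n (leqnn n)) mn]; exists (Kn n); split => //.
- by move=> t [].
- by move=> t [_ ut]; rewrite -normr_gt0; apply: lt_le_trans ut; rewrite invr_gt0 ltr0n.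
- move=> e e0; have [r r0 H] := WJ e e0; exists r => // c d [Kc _] [Kd _]; exact: H.
Unshelve. all: by end_near. Qed.

End Transversal.

(** * Curves in the Engel group *)

Section VectorCurves.
Context {R : realType}.

Lemma ler_norm_coord m n (A : 'M[R]_(m, n)) i j : `|A i j| <= `|A|.
Proof.
rewrite [leRHS]/Num.Def.normr /= mx_normrE.
exact: (le_bigmax _ (fun ij : 'I_m * 'I_n => `|A ij.1 ij.2|) (i, j)).
Qed.

Lemma is_derive_coord (f : R -> 'rV[R]_4) (t : R) (l : 'rV[R]_4) i :
  is_derive t 1 f l -> is_derive t 1 (fun s => f s 0 i) (l 0 i).
Proof.
move=> [df <-]; apply: DeriveDef; first by move/derivable_mxP : df.
by rewrite derive_mx // mxE.
Qed.

Lemma absolutely_continuous_coord a b (f : R -> 'rV[R]_4) i :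
  absolutely_continuous a b f -> absolutely_continuous a b (fun s => f s 0 i).
Proof.
move=> fac; apply: (absolutely_continuous_lip (L := 1) _ fac fac) => u v _ _ _.
rewrite mul1r (@le_trans _ _ `|f v - f u|) ?lerDl //.
by have := ler_norm_coord (f v - f u) 0 i; rewrite !mxE.
Qed.

Lemma is_derive_scale_vector (V : normedModType R) (f : R -> R) (v : V) (t l : R) :
  is_derive t 1 f l -> is_derive t 1 (fun s => f s *: v) (l *: v).
Proof.
move=> /is_deriveP H; apply/is_deriveP => e e0.
have v1 : 0 < `|v| + 1 by rewrite ltr_wpDl.
have [d d0 Hd] := H _ (divr_gt0 e0 v1); exists d => // s st.
have -> : f s *: v - f t *: v - (s - t) *: (l *: v) = (f s - f t - (s - t) * l) *: v.
  by rewrite scalerA -!scalerBl.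
rewrite normrZ; apply: (@le_trans _ _ (e / (`|v| + 1) * `|s - t| * `|v|)).
  by rewrite ler_wpM2r //; exact: Hd.
rewrite mulrAC ler_wpM2r // mulrAC ler_pdivrMr // ler_wpM2l // ?ltW //.
by rewrite ltrDl.
Qed.

Lemma is_derive_has_derivative_on (V : normedModType R) a b (f : R -> V) (t : R) l :
  is_derive t 1 f l -> has_derivative_on a b f t l.
Proof.
move=> /is_deriveP H; apply/has_derivative_onP => e e0.
by have [d d0 Hd] := H e e0; exists d => // s _; exact: Hd.
Qed.

Lemma C1_absolutely_continuous a b (f df : R -> R) : continuous df ->
  (forall t : R, is_derive t 1 f (df t)) -> absolutely_continuous a b f.
Proof.
move=> dfc fd; have [ab|ba] := leP a b; last first.
  move=> e e0; exists 1 => // n u v uv _ _; rewrite big1 // => i _.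
  by have [h1 [h2 h3]] := uv i; have := le_lt_trans (le_trans h1 (le_trans h2 h3)) ba; rewrite ltxx.
have [|c cab cM] := @EVT_max R (fun t => `|df t|) a b ab.
  by apply: continuous_subspaceT => t; apply: cvg_norm; exact: dfc.
have := @absolutely_continuous_id R a b => idac.
apply: (absolutely_continuous_lip (L := `|df c|) _ idac idac) => u v au uv vb.
have [//|x xuv ->] := MVT_segment uv (fun x _ => fd x).
  by apply: continuous_subspaceT => t; exact: is_derive_cts (fd t).
rewrite normrM mulrDr ler_wpDr ?mulr_ge0 // ler_wpM2r //; apply: cM.
move: xuv; rewrite !in_itv /= => /andP[ux xv].
by rewrite (le_trans au ux) (le_trans xv vb).
Qed.

Lemma absolutely_continuous_scale_vector (V : normedModType R) a b (f : R -> R) (v : V) :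
  absolutely_continuous a b f -> absolutely_continuous a b (fun s => f s *: v).
Proof.
move=> fac; apply: (absolutely_continuous_lip (L := `|v|) _ fac fac) => p q _ _ _.
by rewrite -scalerBl normrZ mulrC ler_wpM2l // lerDl.
Qed.

End VectorCurves.

Section EngelArcs.
Context {R : realType}.

Definition row4 (c1 c2 c3 c4 : R) : 'rV[R]_4 :=
  c1 *: delta_mx 0 0 + c2 *: delta_mx 0 1 + c3 *: delta_mx 0 2 + c4 *: delta_mx 0 3.

Lemma row4E (A : 'rV[R]_4) : A = row4 (A 0 0) (A 0 1) (A 0 2) (A 0 3).
Proof.
apply/rowP => i; rewrite !mxE /=.
case: i => [[|[|[|[|//]]]] hi]; rewrite /= ?mulr0 ?mulr1 ?addr0 ?add0r;
  congr (A _ _); exact: val_inj.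
Qed.

Lemma row4_coord (c1 c2 c3 c4 : R) :
  [/\ row4 c1 c2 c3 c4 0 0 = c1, row4 c1 c2 c3 c4 0 1 = c2,
      row4 c1 c2 c3 c4 0 2 = c3 & row4 c1 c2 c3 c4 0 3 = c4].
Proof. by split; rewrite !mxE /= ?mulr0 ?mulr1 ?addr0 ?add0r. Qed.

(** The coordinates of a horizontal vector: those of the derivative of an arc. *)
Lemma engel_field_row4 (x : 'rV[R]_4) (v1 v2 : R) :
  v1 *: engel_field1 x + v2 *: engel_field2 x =
  row4 v1 v2 (x 0 0 * v2) (x 0 0 ^+ 2 / 2 * v2).
Proof.
rewrite /row4 /engel_field1 /engel_field2 !scalerDr !scalerA !addrA.
by rewrite [v2 * x 0 0]mulrC [v2 * (_ / _)]mulrC.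
Qed.

Definition arc_curve (A : arc R) (t : R) := row4 (ax1 A t) (ax2 A t) (ax3 A t) (ax4 A t).

Lemma arc_curve_C1_horizontal (A : arc R) (a b : R) : C1_horizontal_curve a b (arc_curve A).
Proof.
pose D t := au1 A t *: engel_field1 (arc_curve A t) + au2 A t *: engel_field2 (arc_curve A t).
have DE t : D t = row4 (au1 A t) (au2 A t) (ax1 A t * au2 A t) (ax1 A t ^+ 2 / 2 * au2 A t).
  rewrite /D engel_field_row4 /arc_curve.
  by have [-> _ _ _] := row4_coord (ax1 A t) (ax2 A t) (ax3 A t) (ax4 A t).
have dA (t : R) : is_derive t 1 (arc_curve A) (D t).
  rewrite DE /row4.
  have h1 := is_derive_scale_vector (delta_mx 0 0 : 'rV[R]_4) (ax1_derive A t).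
  have h2 := is_derive_scale_vector (delta_mx 0 1 : 'rV[R]_4) (ax2_derive A t).
  have h3 := is_derive_scale_vector (delta_mx 0 2 : 'rV[R]_4) (ax3_derive A t).
  have h4 := is_derive_scale_vector (delta_mx 0 3 : 'rV[R]_4) (ax4_derive A t).
  exact: (is_deriveD (is_deriveD (is_deriveD h1 h2) h3) h4).
have c1 : continuous (ax1 A) by move=> t; exact: is_derive_cts (ax1_derive A t).
have u1 := @au1_continuous _ A; have u2 := @au2_continuous _ A.
have c3 : continuous (fun t => ax1 A t * au2 A t).
  by move=> t; apply: cvg_funM; [exact: c1|exact: u2].
have c4 : continuous (fun t => ax1 A t ^+ 2 / 2 * au2 A t).
  move=> t; apply: (cvg_funM (f := fun t => ax1 A t * ax1 A t / 2)); last exact: u2.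
  by apply: cvg_funM; [apply: cvg_funM; exact: c1|exact: cvg_cst].
split; last first.
  exists D; last by move=> t _; exact: is_derive_has_derivative_on.
  apply: continuous_subspaceT => t.
  have -> : D = fun t => row4 (au1 A t) (au2 A t) (ax1 A t * au2 A t) (ax1 A t ^+ 2 / 2 * au2 A t).
    by apply/funext.
  have Z (f : R -> R) (v : 'rV[R]_4) : continuous f -> (fun s => f s *: v) @ t --> f t *: v.
    by move=> fc; apply: cvgZ; [exact: fc|exact: cvg_cst].
  by apply: cvgD; [apply: cvgD; [apply: cvgD|]|]; exact: Z.
split.
  have S := fun (f df : R -> R) i fc fd => absolutely_continuous_scale_vector (delta_mx 0 i : 'rV[R]_4)
    (@C1_absolutely_continuous _ a b f df fc fd).
  apply: absolutely_continuousD; last exact: (S _ _ _ c4 (ax4_derive A)).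
  apply: absolutely_continuousD; last exact: (S _ _ _ c3 (ax3_derive A)).
  apply: absolutely_continuousD; last exact: (S _ _ _ u2 (ax2_derive A)).
  exact: (S _ _ _ u1 (ax1_derive A)).
apply: aeW => t _; exists (au1 A t *: engel_X1 + au2 A t *: engel_X2), (au1 A t), (au2 A t).
by split => //; exact: is_derive_has_derivative_on.
Qed.

End EngelArcs.

Theorem theorem4p3 (R : realType) (a b : R) (gamma : R -> 'rV[R]_4) :
  horizontal_curve a b gamma ->
  (0 < lebesgue_measure (velocity_notin_span_X2 a b gamma))%E ->
  forall eps : R, 0 < eps ->
  exists Gamma : R -> 'rV[R]_4,
    C1_horizontal_curve a b Gamma /\
    (lebesgue_measure (velocity_notin_span_X2 a b gamma) - eps%:E <
     lebesgue_measure [set t : R | t \in `[a, b] /\ Gamma t = gamma t])%E.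
Proof.
set mu := lebesgue_measure; set S := velocity_notin_span_X2 a b gamma.
move=> [gac gae] S0 eps eps0.
have Sab : S `<=` `[a, b]%classic by move=> t [].
have Sfin : mu S \is a fin_num.
  rewrite ge0_fin_numE ?outer_measure_ge0 //.
  apply: (le_lt_trans (le_outer_measure mu _ _ Sab)).
  by rewrite [ltLHS]lebesgue_measure_itv /=; case: ifP => // _; rewrite -EFinB ltry.
have ab : a < b.
  rewrite ltNge; apply/negP => ba; move: S0.
  rewrite lt_neqAle eq_sym => /andP[/eqP + _]; apply.
  apply/eqP; rewrite eq_le outer_measure_ge0 andbT.
  apply: (le_trans (le_outer_measure mu _ _ Sab)).
  by rewrite [leLHS]lebesgue_measure_itv /= lte_fin ltNge ba.
pose x i (t : R) := gamma t 0 i.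
pose u i (t : R) := 'D_1 (x i) t.
pose N := [set t | ~ (t \in `[a, b] -> exists v, horizontal_velocity a b gamma t v)] `|` [set a; b].
have N0 : mu.-negligible N.
  apply: negligibleU; first exact: gae.
  apply: negligibleU; apply/negligibleP => //; exact: lebesgue_measure_set1.
have vel t : a <= t <= b -> ~ N t -> forall v1 v2,
    has_derivative_on a b gamma t (v1 *: engel_field1 (gamma t) + v2 *: engel_field2 (gamma t)) ->
    [/\ is_derive t 1 (x 0) v1, is_derive t 1 (x 1) v2, is_derive t 1 (x 2) (x 0 t * v2)
      & is_derive t 1 (x 3) (x 0 t ^+ 2 / 2 * v2)].
  move=> /andP[at_ tb] Nt v1 v2; rewrite engel_field_row4 => gd.
  have tab : t \in `]a, b[.
    rewrite in_itv /= !lt_neqAle at_ tb !andbT; apply/andP; split.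
      by apply/eqP => ta; apply: Nt; right; left.
    by apply/eqP => ta; apply: Nt; right; right.
  move/(has_derivative_on_is_derive _ _ tab) : gd => gd.
  have [e1 e2 e3 e4] := row4_coord v1 v2 (gamma t 0 0 * v2) (gamma t 0 0 ^+ 2 / 2 * v2).
  have h i := is_derive_coord i gd.
  by split; [have := h 0; rewrite e1|have := h 1; rewrite e2|
    have := h 2; rewrite e3|have := h 3; rewrite e4].
have D t : a <= t <= b -> ~ N t ->
    [/\ is_derive t 1 (x 0) (u 0 t), is_derive t 1 (x 1) (u 1 t), is_derive t 1 (x 2) (x 0 t * u 1 t)
      & is_derive t 1 (x 3) (x 0 t ^+ 2 / 2 * u 1 t)].
  move=> tab Nt; have [v [v1 [v2 [gd _]]]] : exists v, horizontal_velocity a b gamma t v.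
    by apply: contrapT => h; apply: Nt; left => h'; apply: h; apply: h'; rewrite in_itv.
  have [d1 d2 d3 d4] := vel t tab Nt v1 v2 gd.
  have -> : u 0 t = v1 by exact: derive_val.
  by have -> : u 1 t = v2 by exact: derive_val.
have xac i : absolutely_continuous a b (x i) by exact: absolutely_continuous_coord.
pose J t := Jet (x 0 t) (x 1 t) (x 2 t) (x 3 t) (u 0 t) (u 1 t).
have SJ t : S t -> ~ N t -> ju1 (J t) != 0.
  move=> [tab [v [v1 [v2 [gd ->]]] vX2]] Nt; apply: contra vX2 => /eqP /= u0.
  rewrite in_itv /= in tab; have [d1 _ _ _] := vel t tab Nt v1 v2 gd.
  have v10 : v1 = 0 by rewrite -u0 /u; apply/esym; exact: derive_val.
  by rewrite v10 scale0r add0r; apply/vlineP; exists v2.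
(* K must lose less than eps, and must also keep positive measure: the extension
   theorem needs a nonempty set *)
pose e := Num.min (eps / 2) (fine (mu S) / 2).
have e0 : 0 < e by rewrite lt_min !divr_gt0 // fine_gt0 // S0 ltey_eq Sfin.
have [K [cK Kab KN mK WJ]] := large_whitney_set ab (xac 0) (xac 1) (xac 2) (xac 3) N0
  (fun s h n => let: And4 h _ _ _ := D s h n in h) (fun s h n => let: And4 _ h _ _ := D s h n in h)
  (fun s h n => let: And4 _ _ h _ := D s h n in h) (fun s h n => let: And4 _ _ _ h := D s h n in h) e0.
have KnN t : K t -> ~ N t by move=> Kt Nt; have : (K `&` N) t by []; rewrite KN.
pose K1 := K `&` [set t | ju1 (J t) != 0].
have SK : (mu S <= mu K1 + e%:E)%E.
  apply: (@le_trans _ _ (mu K1 + mu (`[a, b]%classic `\` K))%E); last by rewrite leeD2l.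
  apply: (le_trans _ (outer_measureU2 _ _ _)); apply: le_outer_measure => t St.
  have [Kt|nKt] := pselect (K t); last by right; split => //; exact: Sab.
  by left; split => //=; apply: SJ => //; exact: KnN.
have mK1 : (mu S - eps%:E < mu K1)%E.
  have : (mu S - e%:E <= mu K1)%E by rewrite leeBlDr.
  apply: lt_le_trans; rewrite -(fineK Sfin) -!EFinB lte_fin ltrD2l ltrN2.
  by apply: (@le_lt_trans _ _ (eps / 2)); [rewrite ge_min lexx|lra].
have mK1' : (0 < mu K1)%E.
  have : (mu S - e%:E <= mu K1)%E by rewrite leeBlDr.
  apply: lt_le_trans; rewrite -(fineK Sfin) -EFinB lte_fin subr_gt0.
  apply: (@le_lt_trans _ _ (fine (mu S) / 2)); first by rewrite ge_min lexx orbT.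
  by have : 0 < fine (mu S) by [rewrite fine_gt0 // S0 ltey_eq Sfin]; lra.
have [K2 [cK2 K2K mK2 uK2 WJ2]] : exists K2 : set R, [/\ closed K2, K2 `<=` K,
    (maxe 0 (mu S - eps%:E) < mu K2)%E,
    (forall t, K2 t -> ju1 (J t) != 0) & whitney_jets K2 J].
  by apply: (large_transversal_set cK WJ); rewrite gt_max mK1' mK1.
have [mK2_pos mK2_large] : (0 < mu K2)%E /\ (mu S - eps%:E < mu K2)%E.
  by move: mK2; rewrite gt_max => /andP[].
have K2_neq0 : K2 !=set0.
  apply/set0P/negP => /eqP K20; move: mK2_pos.
  by rewrite K20 /mu measure0 ltxx.
have [A HA] := whitney_arc cK2 K2_neq0 uK2 WJ2.
exists (arc_curve A); split; first exact: arc_curve_C1_horizontal.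
apply: (lt_le_trans mK2_large); apply: le_outer_measure => t K2t.
split; first by have := Kab _ (K2K _ K2t).
rewrite [RHS]row4E /arc_curve.
by have [-> -> -> -> _ _] := HA t K2t.
Qed.
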